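(* Let $T>0$, $m>5$, let $\mathbf u_0=(a(z),b(x,z))\in H^m(\Omega)$ and $\mathbf f=(f_1(t,z),f_2(t,x,z))\in C^\infty([0,T]\times\Omega)$, where $\Omega=[0,L]\times[0,1]$ (periodic in $x$), be independent of the viscosities and assume that for $i=0,1$ and all $x$ the compatibility conditions $$\mathbf u_0(x,i)=0,\qquad \nu_3\,\partial_{zz}a(i)+f_1(0,i)=0,$$ $$a(i)\,\partial_x b(x,i)=\nu_1\,\partial_{xx}b(x,i)+\nu_3\,\partial_{zz}b(x,i)+f_2(0,x,i)$$ hold for the viscosities under consideration. Let $\mathbf u^\nu$ and $\mathbf u^0$ be the viscous and inviscid solutions defined in the context. Then there exists a constant $C$, depending on $\mathbf u_0$ (and on $\mathbf f$, $T$, $L$) but independent of $\nu_1,\nu_3$, such that for all $\nu_1,\nu_3\in(0,1]$ $$\|\mathbf u^\nu-\mathbf u^0\|_{L^\infty(0,T;L^2(\Omega))}\le C(\nu_3^{1/4}+\nu_1).$$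
   Context: Plane-parallel channel flow with anisotropic viscosity. $L>0$ is a period; $\Omega=[0,L]\times[0,1]$ with coordinates $(x,z)$; all functions are $L$-periodic in $x$, and boundary conditions are imposed only at $z=0,1$. (The 3D velocity is $(u_1(t,z),u_2(t,x,z),0)$ and is identified with $(u_1,u_2)$.) Viscous problem: $\mathbf u^\nu=(u_1^\nu(t,z),u_2^\nu(t,x,z))$ is the classical solution on $\Omega\times(0,T)$ of $$\partial_t u_1^\nu-\nu_3\partial_{zz}u_1^\nu=f_1,\qquad \partial_t u_2^\nu+u_1^\nu\partial_x u_2^\nu-\nu_1\partial_{xx}u_2^\nu-\nu_3\partial_{zz}u_2^\nu=f_2,$$ with $u_1^\nu=u_2^\nu=0$ at $z=0,1$ and $\mathbf u^\nu|_{t=0}=\mathbf u_0=(a,b)$. Here $\nu=(\nu_1,\nu_3)$, with $\nu_1$ the tangential and $\nu_3$ the normal viscosity. Inviscid (Euler) problem: $\mathbf u^0=(u_1^0(t,z),u_2^0(t,x,z))$ is the classical solution of $\partial_t u_1^0=f_1$, $\partial_t u_2^0+u_1^0\partial_x u_2^0=f_2$, $\mathbf u^0|_{t=0}=\mathbf u_0$. *)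

(* Defs.v *)
From HB Require Import structures.
From mathcomp Require Import all_boot all_order all_algebra.
From mathcomp Require Import all_classical all_reals all_analysis.

Set Implicit Arguments.
Unset Strict Implicit.
Unset Printing Implicit Defensive.

Import Order.TTheory GRing.Theory Num.Theory.
Import numFieldNormedType.Exports.

Local Open Scope classical_set_scope.
Local Open Scope ring_scope.

(* A function on the x-periodic channel is a function of (x, z) in R x [0, 1],
   L-periodic in x; one period Omega = [0, L] x [0, 1] is used only as domain
   of integration.  Time-dependent functions take (t, x, z), in this order, and
   u1, a, f1, which do not depend on x, are functions of (t, z), z, (t, z). *)
Section Channel.
Context {R : realType}.
Implicit Types (L T x z t : R) (v phi g : R -> R -> R) (F : R -> R -> R -> R).

Definition dx v : R -> R -> R := fun x z => derive1 (v^~ z) x.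
Definition dz v : R -> R -> R := fun x z => derive1 (v x) z.
Definition dt F : R -> R -> R -> R := fun t x z => derive1 (fun s => F s x z) t.

Definition continuous2 (D : set (R * R)) v : Prop :=
  {within D, continuous (fun p : R * R => v p.1 p.2)}.
Definition continuous3 (D : set (R * R * R)) F : Prop :=
  {within D, continuous (fun p : R * R * R => F p.1.1 p.1.2 p.2)}.

Definition channel : set (R * R) := setT `*` `[0, 1].
Definition cylinder T : set (R * R * R) := `[0, T] `*` setT `*` `[0, 1].
Definition open_cylinder T : set (R * R * R) := `]0, T[ `*` setT `*` `]0, 1[.

(* Derivative relative to I: the two-sided derivative at interior points of an
   interval I, the one-sided derivative at its end points. *)
Definition derivable_on (I : set R) (h : R -> R) (y : R) : Prop :=
  cvg ((fun e => e^-1 *: (h (e + y) - h y)) @ within [set e | I (e + y)] 0^').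
Definition derive_on (I : set R) (h : R -> R) (y : R) : R :=
  lim ((fun e => e^-1 *: (h (e + y) - h y)) @ within [set e | I (e + y)] 0^').

(* C^k and C^oo on the closed cylinder [0, T] x R x [0, 1], up to the boundary *)
Fixpoint Ck_cylinder T (k : nat) F : Prop :=
  continuous3 (cylinder T) F /\
  if k is k'.+1 then
    [/\ forall t x z, cylinder T (t, x, z) ->
          [/\ derivable_on `[0, T] (fun s => F s x z) t,
              derivable (F t ^~ z) x 1
            & derivable_on `[0, 1] (F t x) z],
        Ck_cylinder T k'
          (fun t x z => derive_on `[0, T] (fun s => F s x z) t),
        Ck_cylinder T k' (fun t => dx (F t))
      & Ck_cylinder T k' (fun t x z => derive_on `[0, 1] (F t x) z)]
  else True.
Definition smooth_cylinder T F : Prop := forall k, Ck_cylinder T k F.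

Fixpoint Ck_plane (k : nat) phi : Prop :=
  continuous2 setT phi /\
  if k is k'.+1 then
    [/\ forall x z, derivable (phi^~ z) x 1 /\ derivable (phi x) z 1,
        Ck_plane k' (dx phi)
      & Ck_plane k' (dz phi)]
  else True.

(* C^oo functions, L-periodic in x, with compact support in 0 < z < 1 *)
Definition test_function L phi : Prop :=
  [/\ forall k, Ck_plane k phi,
      forall z, periodic (phi^~ z) L
    & exists2 d, 0 < d & forall x z, z < d \/ 1 - d < z -> phi x z = 0].

Definition lebesgue2 := (@lebesgue_measure R \x @lebesgue_measure R)%E.
Definition Omega L : set (R * R) := `[0, L] `*` `[0, 1].

(* L^p(D) norm, through the extension by 0 outside D *)
Definition Lnorm_on d (X : measurableType d) (mu : {measure set X -> \bar R})
    (p : \bar R) (D : set X) (h : X -> \bar R) : \bar R :=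
  'N[mu]_p[h \_ D].

Definition L2_Omega L v : Prop :=
  measurable_fun (Omega L) (fun p : R * R => v p.1 p.2) /\
  (Lnorm_on lebesgue2 2%:E (Omega L) (fun p => (v p.1 p.2)%:E) < +oo)%E.

(* g is the weak derivative d_x^i d_z^j v.  The test functions are periodic, so
   these are derivatives on the cylinder (R / L Z) x ]0, 1[. *)
Definition weak_derivative L (i j : nat) v g : Prop :=
  forall phi, test_function L phi ->
    \int[lebesgue2]_(p in Omega L)
      (v p.1 p.2 * iter i dx (iter j dz phi) p.1 p.2) =
    (-1) ^+ (i + j) * \int[lebesgue2]_(p in Omega L) (g p.1 p.2 * phi p.1 p.2).

(* H^m(Omega).  Only m > 1 is used, where H^m embeds into the continuous
   functions: v stands for the continuous representative of its class, so that
   its values and its derivatives in the compatibility conditions make sense. *)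
Definition Hm L (m : nat) v : Prop :=
  [/\ forall z, 0 <= z <= 1 -> periodic (v^~ z) L,
      continuous2 channel v,
      L2_Omega L v
    & forall i j : nat, (i + j <= m)%N ->
        exists2 g, L2_Omega L g & weak_derivative L i j v g].

Definition compatible (nu1 nu3 : R) (a : R -> R) (b : R -> R -> R)
    (f1 : R -> R -> R) (f2 : R -> R -> R -> R) : Prop :=
  forall i x : R, i = 0 \/ i = 1 ->
    [/\ a i = 0, b x i = 0,
        nu3 * derive_on `[0, 1] (derive_on `[0, 1] a) i + f1 0 i = 0
      & a i * dx b x i =
        nu1 * dx (dx b) x i
        + nu3 * derive_on `[0, 1] (derive_on `[0, 1] (b x)) i + f2 0 x i].

(* The regularity asked of a classical solution is minimal: it is continuous on
   the closed cylinder, and the derivatives in its equation exist and are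
   continuous in the open cylinder. *)
Definition parabolic_regular T F : Prop :=
  [/\ continuous3 (cylinder T) F,
      forall t x z, open_cylinder T (t, x, z) ->
        [/\ derivable (fun s => F s x z) t 1,
            derivable (F t ^~ z) x 1, derivable (dx (F t) ^~ z) x 1,
            derivable (F t x) z 1 & derivable (dz (F t) x) z 1]
    & [/\ continuous3 (open_cylinder T) (dt F),
          continuous3 (open_cylinder T) (fun t => dx (F t)),
          continuous3 (open_cylinder T) (fun t => dx (dx (F t))),
          continuous3 (open_cylinder T) (fun t => dz (F t))
        & continuous3 (open_cylinder T) (fun t => dz (dz (F t)))]].

Definition transport_regular T F : Prop :=
  [/\ continuous3 (cylinder T) F,
      forall t x z, open_cylinder T (t, x, z) ->
        derivable (fun s => F s x z) t 1 /\ derivable (F t ^~ z) x 1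
    & continuous3 (open_cylinder T) (dt F) /\
      continuous3 (open_cylinder T) (fun t => dx (F t))].

Definition const_x (w : R -> R -> R) : R -> R -> R -> R := fun t _ z => w t z.

Definition periodic_initial L T (a : R -> R) (b : R -> R -> R)
    (u1 : R -> R -> R) (u2 : R -> R -> R -> R) : Prop :=
  [/\ forall t z, 0 <= t <= T -> 0 <= z <= 1 -> periodic (u2 t ^~ z) L,
      forall z, 0 <= z <= 1 -> u1 0 z = a z
    & forall x z, 0 <= z <= 1 -> u2 0 x z = b x z].

Definition viscous_solution L T (nu1 nu3 : R) (a : R -> R) (b : R -> R -> R)
    (f1 : R -> R -> R) (f2 : R -> R -> R -> R)
    (u1 : R -> R -> R) (u2 : R -> R -> R -> R) : Prop :=
  [/\ parabolic_regular T (const_x u1),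
      parabolic_regular T u2,
      periodic_initial L T a b u1 u2,
      forall t x i, 0 <= t <= T -> i = 0 \/ i = 1 ->
        u1 t i = 0 /\ u2 t x i = 0
    & forall t x z, open_cylinder T (t, x, z) ->
        dt (const_x u1) t x z - nu3 * dz (dz (const_x u1 t)) x z = f1 t z /\
        dt u2 t x z + u1 t z * dx (u2 t) x z
          - nu1 * dx (dx (u2 t)) x z - nu3 * dz (dz (u2 t)) x z = f2 t x z].

Definition euler_solution L T (a : R -> R) (b : R -> R -> R)
    (f1 : R -> R -> R) (f2 : R -> R -> R -> R)
    (u1 : R -> R -> R) (u2 : R -> R -> R -> R) : Prop :=
  [/\ transport_regular T (const_x u1),
      transport_regular T u2,
      periodic_initial L T a b u1 u2
    & forall t x z, open_cylinder T (t, x, z) ->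
        dt (const_x u1) t x z = f1 t z /\
        dt u2 t x z + u1 t z * dx (u2 t) x z = f2 t x z].

(* || (w1, w2) ||_{L^oo(0, T; L^2(Omega))} *)
Definition Linfty_L2 L T (w1 : R -> R -> R) (w2 : R -> R -> R -> R) : \bar R :=
  Lnorm_on (@lebesgue_measure R) +oo%E `]0, T[ (fun t =>
    Lnorm_on lebesgue2 2%:E (Omega L) (fun p =>
      (Num.sqrt (w1 t p.2 ^+ 2 + w2 t p.1 p.2 ^+ 2))%:E)).

End Channel.

(* Main.v *)
Require Import Defs.
From mathcomp Require Import all_boot all_order all_algebra.
From mathcomp Require Import all_classical all_reals all_analysis.
From mathcomp Require Import measurable_realfun ess_sup_inf ring lra.

Set Implicit Arguments.
Unset Strict Implicit.
Unset Printing Implicit Defensive.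

Import Order.TTheory GRing.Theory Num.Theory.
Import numFieldNormedType.Exports.

Local Open Scope classical_set_scope.
Local Open Scope ring_scope.

(** Why the estimate holds.  The difference of the viscous and the inviscid solution
    solves a parabolic problem whose sources are the second derivatives of the
    inviscid solution, multiplied by the viscosities, and whose wall values are
    opposite to those of the inviscid solution.  A comparison principle bounds
    the difference pointwise by C (nu1 + nu3) plus C times two boundary layers
    exp(- z / sqrt nu3) and exp(- (1 - z) / sqrt nu3), and the L2 norm of such a
    layer is of order nu3^(1/4).

    The first components are compared first ([viscous_u1_close]).  For the second
    components ([viscous_u2_close]) the difference of the drifts is one more source;
    it is concentrated in the same layers, and multiplying the barrier by a factor
    growing linearly in time absorbs it.  The barrier exp(t) exp(- z / sqrt nu3) is
    an exact solution of the heat equation with viscosity nu3, so the constants do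
    not depend on the viscosities.

    The inviscid solution enters the comparison ([comparison]) only through bounds
    on its second differences, for at a maximum of the error second differences of
    the viscous solution are controlled by those of the inviscid one.  Such bounds
    are transported along the characteristics ([transported_combination],
    [euler_v2_zz]) from the same bounds ([tame]) on the data.

    For the initial data these bounds are a Sobolev embedding ([Hm_tame]).  A second
    difference of v is the limit of the integrals of v against differences of
    concentrated kernels k(x) l(z).  A concentrated kernel of mass 1 is the sum of a
    fixed function and of the derivative of a bounded function, namely the
    difference of two steps; its difference of order r is therefore, up to a
    harmless term, a derivative of order r + 1 of a function of size h^r
    ([kernel_atoms]).  Moving these derivatives onto v costs weak derivatives of
    order at most 3 in each variable, and gives a bound that is independent of the
    concentration. *)

(** * Calculus on the line *)
Section Calculus.
Context {R : realType}.
Implicit Types (f g : R -> R) (x y w h a b c d e th K A : R).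

Lemma derD f g x a b : is_derive x 1 f a -> is_derive x 1 g b ->
  is_derive x 1 (fun y => f y + g y) (a + b).
Proof. by move=> ? ?; exact: is_deriveD. Qed.

Lemma derB f g x a b : is_derive x 1 f a -> is_derive x 1 g b ->
  is_derive x 1 (fun y => f y - g y) (a - b).
Proof. by move=> ? ?; exact: is_deriveB. Qed.

Lemma derN f x a : is_derive x 1 f a -> is_derive x 1 (fun y => - f y) (- a).
Proof. by move=> ?; exact: is_deriveN. Qed.

Lemma derZ f x c a : is_derive x 1 f a -> is_derive x 1 (fun y => c * f y) (c * a).
Proof. by move=> ?; exact: is_deriveZ. Qed.

Lemma derM f g x a b : is_derive x 1 f a -> is_derive x 1 g b ->
  is_derive x 1 (fun y => f y * g y) (a * g x + f x * b).
Proof.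
move=> ? ?; have := @is_deriveM _ _ f g x 1 a b _ _.
move=> /(_ _ _)/is_derive_eq; apply.
by rewrite /GRing.scale /=; ring.
Qed.

Lemma derC x c : is_derive x 1 (fun _ : R => c) (0 : R).
Proof. exact: is_derive_cst. Qed.

Lemma derI x : is_derive x 1 (fun y : R => y) (1 : R).
Proof. exact: is_derive_id. Qed.

Lemma derO f g x a b : is_derive x 1 f a -> is_derive (f x) 1 g b ->
  is_derive x 1 (fun y => g (f y)) (b * a).
Proof. by move=> ? ?; exact: is_derive1_comp. Qed.

Lemma der_eq f x a b : is_derive x 1 f a -> a = b -> is_derive x 1 f b.
Proof. by move=> ? <-. Qed.

Lemma der_affine f x c d a : is_derive (c * x + d) 1 f a ->
  is_derive x 1 (fun y => f (c * y + d)) (c * a).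
Proof.
have fg : is_derive x 1 (fun y : R => c * y + d) c.
  apply: der_eq (derD (derZ c (derI x)) (derC x d)) _.
  by rewrite mulr1 addr0.
by rewrite [c * a]mulrC => fa; exact: (derO fg).
Qed.

Lemma der_shift f x d a : is_derive (x + d) 1 f a ->
  is_derive x 1 (fun y => f (y + d)) a.
Proof.
move=> fa; have fg : is_derive x 1 (fun y : R => y + d) 1.
  by apply: der_eq (derD (derI x) (derC x d)) _; rewrite addr0.
by have := derO fg fa; rewrite mulr1.
Qed.

Lemma der_derive1 f x : derivable f x 1 -> is_derive x 1 f (derive1 f x).
Proof. by rewrite derive1E; exact: derivableP. Qed.

Lemma derX f x a n : is_derive x 1 f a ->
  is_derive x 1 (fun y => f y ^+ n) (n%:R * f x ^+ n.-1 * a).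
Proof.
move=> fa; elim: n => [|n IH].
  by rewrite !mul0r; under eq_fun do rewrite expr0; exact: derC.
under eq_fun do rewrite exprS; apply: der_eq (derM fa IH) _.
by case: n {IH} => [|n] /=; rewrite ?exprS -?natr1; ring.
Qed.

Lemma der_continuous f x a : is_derive x 1 f a -> {for x, continuous f}.
Proof. by move=> [fx _]; apply: differentiable_continuous; apply/derivable1_diffP. Qed.

Lemma within_segment f a b : (forall x, a <= x <= b -> {for x, continuous f}) ->
  {within `[a, b], continuous f}.
Proof.
move=> cf; apply: continuous_in_subspaceT => x.
by rewrite inE /= in_itv => /cf.
Qed.


(** Increment form of the derivative: it stays meaningful at a zero increment,
    so estimates along curves need no case distinction. *)
Lemma der_epsP f x a : is_derive x 1 f a <->
  (forall e : R, 0 < e -> exists2 d : R, 0 < d & forall h, `|h| < d ->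
    `|f (x + h) - f x - a * h| <= e * `|h|).
Proof.
split=> [[df <-] e e0|H].
  have /cvgrPdist_le /(_ e e0) : h^-1 *: (f (h *: 1 + x) - f x) @[h --> 0^'] --> 'D_1 f x.
    exact: df.
  move=> /nbhs_ballP[d /= d0 dP]; exists d => // h hd.
  have [->|h0] := eqVneq h 0; first by rewrite addr0 subrr mulr0 subrr !normr0 mulr0.
  have := dP h; rewrite /ball/= sub0r normrN => /(_ hd h0).
  rewrite /GRing.scale /= mulr1 [h + x]addrC -(ler_pM2r (x := `|h|)) ?normr_gt0//.
  by rewrite -normrM mulrBl mulrAC mulVf// mul1r distrC.
have cv : h^-1 *: (f (h *: 1 + x) - f x) @[h --> 0^'] --> a.
  apply/cvgrPdist_le => e e0; have [d d0 dP] := H e e0.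
  apply/nbhs_ballP; exists d => //= h; rewrite /ball/= sub0r normrN => hd h0.
  rewrite /GRing.scale /= mulr1 [h + x]addrC -(ler_pM2r (x := `|h|)) ?normr_gt0//.
  rewrite -normrM mulrBl mulrAC mulVf// mul1r distrC; exact: dP.
split; last exact/cvg_lim.
by apply/cvg_ex; exists a.
Qed.

Lemma mvt f (df : R -> R) a b : a < b ->
  (forall x, a < x < b -> is_derive x 1 f (df x)) ->
  {within `[a, b], continuous f} ->
  exists2 c, a < c < b & f b - f a = df c * (b - a).
Proof.
move=> ab fd fc.
have fd' x : x \in `]a, b[ -> is_derive x 1 f (df x) by rewrite in_itv => /fd.
by have [c] := MVT ab fd' fc; rewrite in_itv; exists c.
Qed.

Lemma mvt_le f (df : R -> R) a b K : a <= b ->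
  (forall x, a < x < b -> is_derive x 1 f (df x)) ->
  {within `[a, b], continuous f} ->
  (forall x, a < x < b -> `|df x| <= K) -> `|f b - f a| <= K * (b - a).
Proof.
rewrite le_eqVlt => /predU1P[->|ab] fd fc dfK; first by rewrite !subrr normr0 mulr0.
have [c cab ->] := mvt ab fd fc.
rewrite normrM [`|b - a|]ger0_norm ?subr_ge0 ?(ltW ab)//.
by rewrite ler_wpM2r ?dfK// subr_ge0 ltW.
Qed.

Definition diff h q : R -> R := fun y => q (y + h) - q y.

Lemma diff_is_derive r h q q' y :
  (forall j, (j <= r)%N -> is_derive (y + j%:R * h) 1 q (q' (y + j%:R * h))) ->
  is_derive y 1 (iter r (diff h) q) (iter r (diff h) q' y).
Proof.
elim: r y => [|r IH] y hq /=; first by have := hq 0%N isT; rewrite mul0r addr0.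
apply: derB; last by apply: IH => j jr; apply: hq; exact: leqW.
apply: der_shift; apply: IH => j jr; have := hq j.+1 jr.
by rewrite -natr1 mulrDl mul1r addrA addrAC.
Qed.

(** The mean value theorem, r times.  The parameter th runs over the segment swept
    by the r steps, which makes the bound local. *)
Lemma diff_le r (q : nat -> R -> R) h y A :
  (forall k (th : R), (k < r)%N -> 0 <= th <= r%:R ->
    is_derive (y + th * h) 1 (q k) (q k.+1 (y + th * h))) ->
  (forall th : R, 0 <= th <= r%:R -> `|q r (y + th * h)| <= A) ->
  `|iter r (diff h) (q 0%N) y| <= `|h| ^+ r * A.
Proof.
elim: r y q => [|r IH] y q dq qA /=.
  by rewrite expr0 mul1r; have := qA 0; rewrite mul0r addr0; apply; rewrite !lexx.
pose G := iter r (diff h) (q 0%N).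
have dG (th : R) : 0 <= th <= 1 ->
    is_derive (h * th + y) 1 G (iter r (diff h) (q 1%N) (h * th + y)).
  move=> /andP[t0 t1]; apply: diff_is_derive => j jr.
  rewrite [h * th]mulrC [_ * h + y]addrC -addrA -mulrDl; apply: dq => //.
  by rewrite addr_ge0 ?ler0n//= -natr1 addrC lerD// ler_nat.
have dGt (th : R) : 0 <= th <= 1 -> is_derive th 1 (fun s => G (h * s + y))
   (h * iter r (diff h) (q 1%N) (h * th + y)).
  by move=> t01; apply: der_affine; exact: dG.
have := @mvt_le (fun s => G (h * s + y))
  (fun th => h * iter r (diff h) (q 1%N) (h * th + y)) 0 1 (`|h| ^+ r.+1 * A) ler01.
rewrite mulr1 mulr0 add0r subr0 mulr1 [h + y]addrC; apply.
- by move=> th /andP[t0 t1]; apply: dGt; rewrite !ltW.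
- by apply: within_segment => th t01; exact: der_continuous (dGt th t01).
move=> th /andP[t0 t1]; rewrite normrM exprS -mulrA ler_wpM2l//.
have shiftE s : h * th + y + s * h = y + (th + s) * h by ring.
apply: (IH _ (fun k => q k.+1)) => [k s kr|s] /andP[s0 sr]; rewrite shiftE.
- by apply: dq => //; rewrite -natr1; apply/andP; split; lra.
- by apply: qA; rewrite -natr1; apply/andP; split; lra.
Qed.

(** Smooth functions are carried with all their derivatives, so that taking
    antiderivatives only shifts the index. *)
Definition tower (p : nat -> R -> R) := forall k x, is_derive x 1 (p k) (p k.+1 x).

Lemma tower_continuous p k : tower p -> continuous (p k).
Proof. by move=> tp x; exact: der_continuous (tp k x). Qed.

Lemma tower_tail p k : tower p -> tower (fun i => p (k + i)%N).
Proof. by move=> tp i x; rewrite addnS. Qed.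

Lemma towerB p q : tower p -> tower q -> tower (fun k x => p k x - q k x).
Proof. by move=> tp tq k x; apply: derB. Qed.

Lemma tower_shift p c : tower p -> tower (fun k x => p k (x + c)).
Proof. by move=> tp k x; exact: der_shift. Qed.

Lemma tower_scale p c d : tower p -> tower (fun k x => c * (d ^+ k * p k (d * x))).
Proof.
move=> tp k x; apply: derZ; rewrite exprSr -mulrA; apply: derZ.
have := @der_affine (p k) x d 0 (p k.+1 (d * x)); rewrite addr0 => /(_ (tp _ _)).
by under eq_fun do rewrite addr0.
Qed.

Lemma tower_diff p h r : tower p -> tower (fun k => iter r (diff h) (p k)).
Proof. by move=> tp k x; apply: diff_is_derive. Qed.

Lemma primitive_exists f : continuous f -> exists F, forall x, is_derive x 1 F (f x).
Proof.
move=> cf.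
pose I a b := \int[lebesgue_measure]_(t in `[a, b]) f t.
have fi a b : (@lebesgue_measure R).-integrable `[a, b] (EFin \o f).
  apply: continuous_compact_integrable; first exact: segment_compact.
  exact: continuous_subspaceT.
have split3 a b c : a <= b -> b <= c -> I a c = I a b + I b c.
  move=> ab bc; have := @Rintegral_itvB R f (BLeft a) (BRight c) b (fi a c).
  rewrite !bnd_simp => /(_ ab bc).
  rewrite Rintegral_itv_obnd_cbnd; last first.
    by apply: integrableS (fi b c) => //; exact: subset_itv_oc_cc.
  by rewrite -/(I a c) -/(I a b) -/(I b c) => <-; rewrite addrC subrK.
pose F x := if 0 <= x then I 0 x else - I x 0.
exists F => x.
(* The fundamental theorem differentiates to the right of the base point only:
   the base point is moved to the left of both 0 and x. *)
pose a := - (`|x| + 1); have a0 : a < 0 by rewrite /a oppr_lt0 ltr_pwDr.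
have ax : a < x.
  by rewrite /a ltrNl (le_lt_trans (ler_norm _))// normrN ltrDl.
have FE y : a <= y -> F y = I a y - I a 0.
  move=> ay; rewrite /F; case: ifPn => [y0|]; last rewrite -ltNge => /ltW y0.
  - rewrite (split3 a 0 y (ltW a0) y0); ring.
  - rewrite (split3 a y 0 ay y0); ring.
have [] := @continuous_FTC1_closed R f a x (x + 1) _ (fi _ _) ax (cf x).
  by rewrite ltrDl.
rewrite -/(I a) => Id I'.
suff: is_derive x 1 (fun y => I a y - I a 0) (f x).
  apply: near_eq_is_derive; near=> y; rewrite FE//.
  by near: y; exact: lt_le_nbhsr.
have dI : is_derive x 1 (I a) (f x) by rewrite -I' derive1E; exact: derivableP.
by apply: der_eq (derB dI (derC x (I a 0))) _; rewrite subr0.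
Unshelve. all: by end_near. Qed.

Lemma tower_cons p F : tower p -> (forall x, is_derive x 1 F (p 0%N x)) ->
  tower (fun k => if k is k'.+1 then p k' else F).
Proof. by move=> tp dF [|k]. Qed.

Lemma primitives p n : tower p ->
  exists q : nat -> R -> R, tower q /\ (forall k, q (n + k)%N = p k).
Proof.
move=> tp; elim: n => [|n [q [tq qp]]]; first by exists p.
have [F dF] := primitive_exists (tower_continuous (k := 0) tq).
by exists (fun k => if k is k'.+1 then q k' else F); split; first exact: tower_cons.
Qed.

End Calculus.

(** * A smooth step function *)
Section Bump.
Context {R : realType}.
Implicit Types (f g : R -> R) (x y w h a b c d e th K A : R).

Lemma der_unique f x a b : is_derive x 1 f a -> is_derive x 1 f b -> a = b.
Proof. by move=> [_ <-] [_ <-]. Qed.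

Lemma der_near_cst f x a c : (\forall y \near x, f y = c) -> is_derive x 1 f a ->
  a = 0.
Proof.
move=> fc fa; apply: der_unique fa _.
apply: near_eq_is_derive (derC x c).
by near=> y; apply/esym; near: y.
Unshelve. all: by end_near. Qed.

Fixpoint Cn k f : Prop :=
  if k is k'.+1 then exists2 f' : R -> R, (forall x, is_derive x 1 f (f' x)) & Cn k' f'
  else True.

Lemma CnS k f : Cn k.+1 f -> Cn k f.
Proof. by elim: k f => //= k IH f [f' ff' /IH]; exists f'. Qed.

Lemma CnB k f g : Cn k f -> Cn k g -> Cn k (fun x => f x - g x).
Proof.
elim: k f g => //= k IH f g [f' ff' kf'] [g' gg' kg'].
by exists (fun x => f' x - g' x); [move=> x; exact: derB|exact: IH].
Qed.

Lemma CnD k f g : Cn k f -> Cn k g -> Cn k (fun x => f x + g x).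
Proof.
elim: k f g => //= k IH f g [f' ff' kf'] [g' gg' kg'].
by exists (fun x => f' x + g' x); [move=> x; exact: derD|exact: IH].
Qed.

Lemma CnZ k f c : Cn k f -> Cn k (fun x => c * f x).
Proof.
elim: k f => //= k IH f [f' ff' kf'].
by exists (fun x => c * f' x); [move=> x; exact: derZ|exact: IH].
Qed.

Lemma CnM k f g : Cn k f -> Cn k g -> Cn k (fun x => f x * g x).
Proof.
elim: k f g => // k IH f g kf kg; move: (kf) (kg) => /= [f' ff' kf'] [g' gg' kg'].
exists (fun x => f' x * g x + f x * g' x); first by move=> x; exact: derM.
by apply: CnD; apply: IH => //; exact: CnS.
Qed.

Lemma Cn_affine k f c d : Cn k f -> Cn k (fun x => f (c * x + d)).
Proof.
elim: k f => //= k IH f [f' ff' kf'].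
exists (fun x => c * f' (c * x + d)); first by move=> x; exact: der_affine.
exact/CnZ/IH.
Qed.

(** Derivatives being unique, the finite chains of derivatives of all lengths are
    initial segments of a single one. *)
Lemma smooth_tower f : (forall k, Cn k f) -> exists2 p, tower p & p 0%N = f.
Proof.
move=> Cf; pose p k := iter k (@derive1 _ R) f; exists p => //.
have Cp n k : Cn k (p n).
  elim: n k => // n IH k; have [g dg kg] := IH k.+1; suff <- : g = p n.+1 by [].
  by apply/funext => x; rewrite [RHS]derive1E; have [_ <-] := dg x.
by move=> k x; have -> : p k.+1 x = 'D_1 (p k) x; [exact: derive1E|
  have [g dg _] := Cp k 1%N; apply: derivableP; have [] := dg x].
Qed.

(** x^-n exp(-1/x), extended by 0.  The derivative of each of these functions is a
    combination of two others, so all of them are smooth. *)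
Definition flat (n : nat) x : R := if 0 < x then x^-1 ^+ n * expR (- x^-1) else 0.

Lemma flat0 n x : x <= 0 -> flat n x = 0.
Proof. by rewrite /flat ltNge => ->. Qed.

(** Differentiability of flat n at 0, where the difference quotient is flat n.+1. *)
Lemma flat_le n x : 0 < x -> 0 <= flat n.+1 x <= n.+2`!%:R * x.
Proof.
move=> x0; rewrite /flat x0; apply/andP; split.
  by rewrite mulr_ge0 ?expR_ge0// exprn_ge0// invr_ge0 ltW.
have xV0 : 0 < x^-1 by rewrite invr_gt0.
have F0 : 0 < n.+2`!%:R :> R by rewrite ltr0n fact_gt0.
rewrite expRN ler_pdivrMr ?expR_gt0//.
have e1 : x^-1 ^+ n.+2 / n.+2`!%:R <= expR x^-1.
  by rewrite (le_trans _ (expR_ge1Dxn n.+1 (ltW xV0)))// lerDr.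
have -> : x^-1 ^+ n.+1 = x^-1 ^+ n.+2 * x.
  by rewrite [in RHS]exprSr mulfVK ?gt_eqF.
rewrite ler_pdivrMr// in e1.
by have := ler_wpM2r (ltW x0) e1; lra.
Qed.

Lemma flat_der n x : is_derive x 1 (flat n) (flat n.+2 x - n%:R * flat n.+1 x).
Proof.
have [x0|x0|->] := ltgtP x 0.
- rewrite !flat0 ?(ltW x0)// mulr0 subr0.
  apply: near_eq_is_derive (derC x 0); near=> y; rewrite flat0//.
  by near: y; exact: lt_le_nbhsl.
- rewrite {2 3}/flat x0.
  apply: (@near_eq_is_derive _ _ _ (fun y => y^-1 ^+ n * expR (- y^-1))).
    near=> y; rewrite /flat; suff -> : 0 < y by [].
    by near: y; exact: lt_nbhsr.
  have dV : is_derive x 1 (fun y : R => y^-1) (- x^-1 ^+ 2).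
    apply: is_derive_eq; first by apply: is_deriveV; rewrite gt_eqF.
    by rewrite /GRing.scale/= mulr1 -exprVn.
  have dE := derO (derN dV) (is_derive_expR _).
  have dX : is_derive x 1 (fun y : R => y^-1 ^+ n) (n%:R * x^-1 ^+ n.-1 * - x^-1 ^+ 2).
    exact: derX.
  apply: der_eq (derM dX dE) _.
  by case: n {dX} => [|n]; rewrite !exprS /=; ring.
rewrite !flat0// mulr0 subr0; apply/der_epsP => e e0.
have F0 : 0 < n.+2`!%:R :> R by rewrite ltr0n fact_gt0.
exists (e / n.+2`!%:R) => [|h hd]; first exact: divr_gt0.
rewrite add0r (flat0 n (lexx 0)) mul0r !subr0.
have [h0|h0] := leP h 0; first by rewrite flat0// normr0 mulr_ge0// ltW.
have -> : flat n h = flat n.+1 h * h.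
  by rewrite /flat h0 exprSr mulrAC mulfVK ?gt_eqF.
rewrite normrM ler_wpM2r//; have /andP[f0 fle] := flat_le n h0.
rewrite ger0_norm// (le_trans fle)// mulrC -ler_pdivlMr//.
by rewrite ltW// (le_lt_trans _ hd)// ler_norm.
Unshelve. all: by end_near. Qed.

Lemma flat_Cn k n : Cn k (flat n).
Proof.
elim: k n => // k IH n; exists (fun x => flat n.+2 x - n%:R * flat n.+1 x).
- exact: flat_der.
- by apply: CnB => //; exact: CnZ.
Qed.

Lemma tower_zero p k x : tower p -> (\forall y \near x, p k y = 0) -> p k.+1 x = 0.
Proof. by move=> tp p0; exact: der_near_cst p0 (tp k x). Qed.

Lemma nondecreasing_der f (f' : R -> R) x y : x <= y ->
  (forall w, is_derive w 1 f (f' w)) -> (forall w, 0 <= f' w) -> f x <= f y.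
Proof.
rewrite le_eqVlt => /predU1P[->//|xy] ff' f'0.
have [|c _] := mvt xy (fun w _ => ff' w).
  by apply: within_segment => w _; exact: der_continuous (ff' w).
by rewrite -subr_ge0 => ->; rewrite mulr_ge0// subr_ge0 ltW.
Qed.

(** The step is kept rather than only its derivative, the bump: however narrow
    the bump is made, the step stays between 0 and 1, and this is what makes the
    kernel estimates uniform in the width. *)
Lemma smooth_step : exists2 B : nat -> R -> R, tower B &
  [/\ forall x, x <= -1 -> B 0%N x = 0, forall x, 1 <= x -> B 0%N x = 1,
      forall x, 0 <= B 1%N x & forall k x, 1 < `|x| -> B k.+1 x = 0].
Proof.
pose be x := flat 0 (1 * x + 1) * flat 0 (- 1 * x + 1).
have [p tp p0] : exists2 p, tower p & p 0%N = be.
  by apply: smooth_tower => k; apply: CnM; apply: Cn_affine; exact: flat_Cn.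
have be0 x : 1 <= `|x| -> be x = 0.
  rewrite ler_normr /be => /orP[] x1.
  - by rewrite (@flat0 _ (- 1 * x + 1)) ?mulr0//; lra.
  - by rewrite (@flat0 _ (1 * x + 1)) ?mul0r//; lra.
have be_ge0 x : 0 <= be x.
  by rewrite mulr_ge0// /flat; case: ifP => // _; rewrite expr0 mul1r expR_ge0.
have [F dF] := primitive_exists (tower_continuous (k := 0) tp); rewrite p0 in dF.
have tF := tower_cons tp _.
have cst x y : x <= y -> (forall w, x < w < y -> 1 <= `|w|) -> F y = F x.
  move=> xy w1; apply/eqP; rewrite -subr_eq0 -normr_le0.
  have := mvt_le (K := 0) xy (fun w _ => dF w) _ _; rewrite mul0r; apply.
  - by apply: within_segment => w _; exact: der_continuous (dF w).
  - by move=> w /w1 /be0 ->; rewrite normr0.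
have F01 : F (- 1) < F 1.
  have h2 : 0 < 2^-1 :> R by rewrite invr_gt0.
  have [|c c1 E] := mvt h2 (fun w _ => dF w).
    by apply: within_segment => w _; exact: der_continuous (dF w).
  have le1 : F (-1) <= F 0 by apply: nondecreasing_der be_ge0 => //; rewrite lerN10.
  have le2 : F 2^-1 <= F 1 by apply: nondecreasing_der be_ge0 => //; lra.
  apply: le_lt_trans le1 _; apply: lt_le_trans le2; rewrite -subr_gt0 E.
  move/andP: c1 => [c0 c1]; rewrite subr0 mulr_gt0// /be.
  have flat_gt0 y : 0 < y -> 0 < flat 0 y.
    by move=> y0; rewrite /flat y0 mul1r expR_gt0.
  by rewrite mulr_gt0// flat_gt0//; lra.
pose c := (F 1 - F (-1))^-1.
have c0 : 0 < c by rewrite invr_gt0 subr_gt0.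
exists (fun k x => if k is k'.+1 then c * p k' x else c * (F x - F (-1))).
- case=> [|k] x; last exact: derZ.
  by rewrite p0; apply: derZ; apply: der_eq (derB (dF x) (derC _ _)) _; rewrite subr0.
split=> [x x1|x x1|x|k x x1].
- by rewrite -(cst x (-1)) ?subrr ?mulr0// => w /andP[_ w1]; rewrite ler_normr; lra.
- rewrite (cst 1 x)// => [|w /andP[w1 _]]; last by rewrite ler_normr (ltW w1).
  by rewrite mulVf// gt_eqF// subr_gt0.
- by rewrite p0 mulr_ge0// ltW.
suff -> : p k x = 0 by rewrite mulr0.
elim: k x x1 => [|k IH] x x1; first by rewrite p0 be0// ltW.
apply: tower_zero => //; near=> y; apply: IH.
near: y; exact: cvgr_gt (@norm_continuous _ R x) _ x1.
Unshelve. all: by end_near. Qed.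

End Bump.

(** * Concentrated kernels and their differences *)
Section Kernels.
Context {R : realType}.
Implicit Types (f g : R -> R) (x y w h a b c d e th K A : R).

Lemma iter_diffE r h f g : (forall y, f y = g y) ->
  iter r (diff h) f = iter r (diff h) g.
Proof. by move=> fg; congr iter; exact/funext. Qed.

Lemma iter_diffD r h f g y :
  iter r (diff h) (fun y => f y + g y) y = iter r (diff h) f y + iter r (diff h) g y.
Proof. by elim: r y => //= r IH y; rewrite /diff !IH; ring. Qed.

Lemma iter_diffB r h f g y :
  iter r (diff h) (fun y => f y - g y) y = iter r (diff h) f y - iter r (diff h) g y.
Proof. by elim: r y => //= r IH y; rewrite /diff !IH; ring. Qed.

Lemma iter_diff_shift r h f c y :
  iter r (diff h) (fun y => f (y + c)) y = iter r (diff h) f (y + c).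
Proof. by elim: r y => //= r IH y; rewrite /diff !IH addrAC. Qed.

Lemma iter_diff0 r h f y : (forall j, (j <= r)%N -> f (y + j%:R * h) = 0) ->
  iter r (diff h) f y = 0.
Proof.
elim: r y => [|r IH] y f0 /=; first by have := f0 0%N isT; rewrite mul0r addr0.
rewrite /diff (IH (y + h)) => [|j jr].
  by rewrite IH ?subrr// => j jr; exact/f0/leqW.
by have := f0 j.+1 jr; rewrite -natr1 mulrDl mul1r addrA addrAC.
Qed.

Lemma tower_diff_le r h q A y : tower q ->
  (forall th : R, 0 <= th <= r%:R -> `|q r (y + th * h)| <= A) ->
  `|iter r (diff h) (q 0%N) y| <= `|h| ^+ r * A.
Proof. by move=> tq; apply: diff_le => *; exact: tq. Qed.

(** Differences of order r do not see the r constants of integration of an r-fold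
    antiderivative. *)
Lemma tower_diff_eq0 r h q y : tower q ->
  (forall th : R, 0 <= th <= r%:R -> q r (y + th * h) = 0) ->
  iter r (diff h) (q 0%N) y = 0.
Proof.
move=> tq q0; apply/eqP; rewrite -normr_le0 -(mulr0 (`|h| ^+ r)).
by apply: tower_diff_le => // th /q0 ->; rewrite normr0.
Qed.

(** A one-dimensional kernel that is a derivative, of order at most 3, of an
    admissible function bounded by A.  Pairing it with a function that has weak
    derivatives costs an integral of a weak derivative, times A. *)
Definition atom (S : (R -> R) -> Prop) A f := exists2 i, (i <= 3)%N &
  exists2 p, tower p & [/\ S (p 0%N), forall y, `|p 0%N y| <= A & p i = f].

Definition two_atoms S A f := exists f1 f2, [/\ atom S A f1, atom S A f2 &
  f = fun y => f1 y + f2 y].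

(** For a kernel T' + rho with T bounded, the r-th difference of T' is the
    (r+1)-st derivative of the r-th difference of an r-fold antiderivative of T,
    and that difference is at most |h|^r sup |T|.  The size of T' does not enter,
    so the kernel may be concentrated. *)
Lemma kernel_atoms S r h A (T rho : nat -> R -> R) : (r <= 2)%N ->
  tower T -> tower rho ->
  (forall y, `|T 0%N y| <= A) -> (forall y, `|rho r y| <= A) ->
  (forall q, tower q -> (forall k, q (r + k)%N = T k) ->
     S (iter r (diff h) (q 0%N))) ->
  S (iter r (diff h) (rho 0%N)) ->
  two_atoms S (`|h| ^+ r * A) (iter r (diff h) (fun y => T 1%N y + rho 0%N y)).
Proof.
move=> r2 tT trho TA rhoA ST Srho.
have [q [tq qT]] := primitives r tT.
exists (iter r (diff h) (T 1%N)), (iter r (diff h) (rho 0%N)); split.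
- exists r.+1 => //; exists (fun k => iter r (diff h) (q k)); first exact: tower_diff.
  split; [exact: ST| |by rewrite -[r.+1]addn1 qT].
  by move=> y; apply: tower_diff_le => // th _; rewrite -[r]addn0 qT.
- exists 0%N => //; exists (fun k => iter r (diff h) (rho k)); first exact: tower_diff.
  by split=> // y; apply: tower_diff_le.
- by apply/funext => y; rewrite iter_diffD.
Qed.

Definition cst_tower c : nat -> R -> R := fun k _ => if k is 0%N then c else 0.

Lemma tower_cst c : tower (cst_tower c).
Proof. by case=> [|k] x; exact: derC. Qed.

Section Step.
Variable B : nat -> R -> R.
Hypothesis tB : tower B.
Hypothesis BN : forall x, x <= -1 -> B 0%N x = 0.
Hypothesis B1 : forall x, 1 <= x -> B 0%N x = 1.
Hypothesis Bge : forall x, 0 <= B 1%N x.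
Hypothesis Bout : forall k x, 1 < `|x| -> B k.+1 x = 0.

Lemma step01 x : 0 <= B 0%N x <= 1.
Proof.
apply/andP; split.
- rewrite -(BN (x := Num.min (-1) x)) ?ge_min ?lexx//.
  by apply: nondecreasing_der (tB 0) Bge; rewrite ge_min lexx orbT.
- rewrite -(B1 (x := Num.max 1 x)) ?le_max ?lexx//.
  by apply: nondecreasing_der (tB 0) Bge; rewrite le_max lexx orbT.
Qed.

Lemma bump_bounded k : exists2 K : R, 0 <= K & forall x, `|B k x| <= K.
Proof.
case: k => [|k].
  by exists 1 => // x; have /andP[b0 b1] := step01 x; rewrite ger0_norm.
have cB : {within `[-1, 1], continuous (fun x => `|B k.+1 x|)}.
  apply: within_segment => x _; apply: continuous_comp; last exact: norm_continuous.
  exact: tower_continuous.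
have [|c _ cmax] := EVT_max _ cB; first by rewrite lerN10 || lra.
exists (`|B k.+1 c|) => // x; have [x1|x1] := lerP `|x| 1; last by rewrite Bout// normr0.
by apply: cmax; rewrite in_itv /= -ler_norml.
Qed.

(** A step of width d at c, and its derivatives. *)
Definition bstep d c : nat -> R -> R := fun k y => d^-1 ^+ k * B k (d^-1 * (y - c)).

Lemma tower_bstep d c : tower (bstep d c).
Proof.
move=> k x; have := tower_shift (- c) (tower_scale 1 d^-1 tB) k x.
by rewrite /bstep; under eq_fun do rewrite mul1r; rewrite mul1r.
Qed.

Lemma bstep_lo d c y : 0 < d -> y <= c - d -> bstep d c 0%N y = 0.
Proof.
move=> d0 yc; rewrite /bstep mul1r BN//.
by rewrite mulrC ler_pdivrMr// mulN1r; lra.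
Qed.

Lemma bstep_hi d c y : 0 < d -> c + d <= y -> bstep d c 0%N y = 1.
Proof.
move=> d0 yc; rewrite /bstep mul1r B1//.
by rewrite mulrC ler_pdivlMr// mul1r; lra.
Qed.

Lemma bstep01 d c y : 0 <= bstep d c 0%N y <= 1.
Proof. by rewrite /bstep mul1r step01. Qed.

Lemma bstep_ge0 d c y : 0 < d -> 0 <= bstep d c 1%N y.
Proof. by move=> d0; rewrite /bstep mulr_ge0// expr1 invr_ge0 ltW. Qed.

Lemma bstep_out d c k y : 0 < d -> d < `|y - c| -> bstep d c k.+1 y = 0.
Proof.
move=> d0 yc; rewrite /bstep Bout ?mulr0// normrM gtr0_norm ?invr_gt0//.
by rewrite mulrC ltr_pdivlMr// mul1r.
Qed.


Definition supported f := exists2 e, 0 < e & forall w, w < e \/ 1 - e < w -> f w = 0.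

(** The fixed bump rho carries the mass: the difference of the two steps is then
    compactly supported in ]0, 1[.  The support of rho is in [1/4, 1/2], and the
    bound on h keeps its translates by at most 2 h inside ]0, 1[. *)
Lemma z_kernel : exists2 A, 0 <= A & forall r h d c, (r <= 2)%N -> 0 <= h <= 8^-1 ->
  0 < d -> 0 < c - d -> c + d + r%:R * h < 1 ->
  two_atoms supported (h ^+ r * A) (iter r (diff (- h)) (bstep d c 1%N)).
Proof.
pose rho := bstep 8^-1 (3 / 8).
have trho : tower rho by exact: tower_bstep.
have rho_bd k : exists2 K : R, 0 <= K & forall x, `|rho k x| <= K.
  have [K K0 BK] := bump_bounded k.
  exists (8 ^+ k * K) => [|x]; first by rewrite mulr_ge0// exprn_ge0.
  by rewrite /rho /bstep normrM invrK ger0_norm ?exprn_ge0// ler_wpM2l// exprn_ge0.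
have [K1 K10 rho1] := rho_bd 1%N; have [K2 K20 rho2] := rho_bd 2%N.
have [K3 K30 rho3] := rho_bd 3%N.
exists (1 + K1 + K2 + K3) => [|r h d c r2 /andP[h0 h8] d0 cd0 cd1]; first by lra.
pose T k y := bstep d c k y - rho k y.
have rh : 0 <= r%:R * h <= 4^-1.
  rewrite mulr_ge0//=; have : r%:R <= 2 :> R by rewrite (ler_nat _ r 2).
  have : 0 <= r%:R :> R by [].
  by nra.
pose e := Num.min (c - d) (Num.min 4^-1 (1 - (c + d + r%:R * h))).
have e0 : 0 < e by rewrite /e !lt_min cd0 subr_gt0 cd1 invr_gt0 ltr0n.
have [e1 e2 e3] : [/\ e <= c - d, e <= 4^-1 & e <= 1 - (c + d + r%:R * h)].
  by rewrite /e !ge_min !lexx !orbT.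
have -> : iter r (diff (- h)) (bstep d c 1%N) =
    iter r (diff (- h)) (fun y => T 1%N y + (fun k => rho k.+1) 0%N y).
  by apply: iter_diffE => y; rewrite /T subrK.
have -> : h ^+ r = `|- h| ^+ r by rewrite normrN ger0_norm.
apply: (@kernel_atoms supported r (- h) _ T (fun k => rho k.+1) r2).
- by apply: towerB => //; exact: tower_bstep.
- exact: (tower_tail 1).
- move=> y; rewrite /T; have /andP[b0 b1] := bstep01 d c y.
  have /andP[c0 c1] := bstep01 8^-1 (3 / 8) y.
  by rewrite ler_norml -/(rho 0%N y); rewrite -/(rho 0%N y) in c0 c1; lra.
- move=> y; have := rho1 y; have := rho2 y; have := rho3 y.
  by case: r r2 {rh cd1 e e0 e1 e2 e3} => [|[|[|//]]] _; lra.
- move=> q tq qT; exists e => // w we; apply: tower_diff_eq0 => // th /andP[t0 t1].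
  have th_h : 0 <= th * h <= r%:R * h by rewrite mulr_ge0//= ler_wpM2r.
  rewrite -[r]addn0 qT /T /rho; case: we => we.
  + by rewrite !bstep_lo ?subrr ?invr_gt0//; lra.
  + by rewrite !bstep_hi ?subrr ?invr_gt0//; lra.
exists e => // w we; apply: iter_diff0 => j jr.
have jh : 0 <= j%:R * h <= r%:R * h by rewrite mulr_ge0//= ler_wpM2r// ler_nat.
apply: bstep_out; first by rewrite invr_gt0.
by rewrite ltr_normr; case: we => we; apply/orP; [right|left]; lra.
Qed.

Section Periodic.
Variable L : R.
Hypothesis L0 : 0 < L.

(** The nearest integer to y / L. *)
Definition rnd y : int := Num.floor (y / L + 2^-1).

Lemma rnd_le y : L * (rnd y)%:~R - L / 2 <= y < L * (rnd y)%:~R + L / 2.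
Proof.
have := floor_itv (y / L + 2^-1); rewrite -/(rnd y) intrD => /andP[n1 n2].
have yE : y = L * (y / L) by rewrite mulrC divfK ?gt_eqF.
rewrite -(ler_pM2l L0) in n1; rewrite -(ltr_pM2l L0) in n2.
by rewrite {2 3}yE; apply/andP; split; lra.
Qed.

Lemma rnd_eq y (n : int) : L * n%:~R - L / 2 <= y < L * n%:~R + L / 2 -> rnd y = n.
Proof.
have yE : y = L * (y / L) by rewrite mulrC divfK ?gt_eqF.
move=> /andP[n1 n2]; apply: floor_def; rewrite intrD.
by apply/andP; split; [rewrite -(ler_pM2l L0)|rewrite -(ltr_pM2l L0)]; lra.
Qed.

(** A staircase that rises by 1 around each multiple of L; its derivatives are
    L-periodic. *)
Definition pstep d k y :=
  bstep d (L * (rnd y)%:~R) k y + (if k is 0%N then (rnd y)%:~R else 0).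

(** Near the half-periods, where rnd jumps, the steps at the two neighbouring
    multiples of L are constant, and the jump of rnd is what separates them. *)
Lemma pstep_local d k y y' : 0 < d < L / 4 -> `|y' - y| < L / 4 ->
  pstep d k y' = bstep d (L * (rnd y)%:~R) k y' +
                 (if k is 0%N then (rnd y)%:~R else 0).
Proof.
move=> /andP[d0 d4] /ltr_normlP[yy1 yy2].
have /andP[r1 r2] := rnd_le y; have /andP[s1 s2] := rnd_le y'.
have far (m n : int) : m < n -> m%:~R + 1 <= n%:~R :> R.
  by move=> mn; rewrite -(intrD _ m 1) ler_int -ltzD1 ltrD2r.
have b_lo (n : int) : y' <= L * n%:~R - L / 4 -> bstep d (L * n%:~R) k y' = 0.
  by move=> le; case: k => [|k]; [apply: bstep_lo => //; lra|
    apply: bstep_out => //; rewrite ltr_normr; apply/orP; right; lra].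
have b_hi (n : int) : L * n%:~R + L / 4 <= y' ->
    bstep d (L * n%:~R) k y' = if k is 0%N then 1 else 0.
  by move=> le; case: k {b_lo} => [|k]; [apply: bstep_hi => //; lra|
    apply: bstep_out => //; rewrite ltr_normr; apply/orP; left; lra].
have L4 : 0 < L / 4 by rewrite divr_gt0.
have adj (m n : int) : m < n -> L * n%:~R < L * m%:~R + 2 * L ->
    n%:~R = m%:~R + 1 :> R.
  move=> mn Lmn; apply/eqP; rewrite eq_le far// andbT -(intrD R m 1) ler_int leNgt.
  apply/negP => /far; rewrite intrD -(ler_pM2l L0) !mulrDr mulr1; lra.
rewrite /pstep; have [rr|rr|<-//] := ltgtP (rnd y') (rnd y).
- have E : (rnd y)%:~R = (rnd y')%:~R + 1 :> R by apply: adj rr _; lra.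
  rewrite E in r1 r2 *.
  have -> : bstep d (L * (rnd y')%:~R) k y' = if k is 0%N then 1 else 0.
    by apply: b_hi; lra.
  have -> : bstep d (L * ((rnd y')%:~R + 1)) k y' = 0.
    by rewrite -E ?b_lo ?E//; lra.
  by case: k {b_lo b_hi} => [|k]; ring.
- have E : (rnd y')%:~R = (rnd y)%:~R + 1 :> R by apply: adj rr _; lra.
  rewrite E in s1 s2 *.
  have -> : bstep d (L * (rnd y)%:~R) k y' = if k is 0%N then 1 else 0.
    by apply: b_hi; lra.
  have -> : bstep d (L * ((rnd y)%:~R + 1)) k y' = 0.
    by rewrite -E ?b_lo ?E//; lra.
  by case: k {b_lo b_hi} => [|k]; ring.
Qed.

Lemma tower_pstep d : 0 < d < L / 4 -> tower (pstep d).
Proof.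
move=> d4 k x.
pose P k y := bstep d (L * (rnd x)%:~R) k y + (if k is 0%N then (rnd x)%:~R else 0).
have PE i : \forall y \near x, P i y = pstep d i y.
  have L4 : 0 < L / 4 by rewrite divr_gt0.
  apply/nbhs_ballP; exists (L / 4) => //= y; rewrite /ball/= distrC => yx.
  by rewrite (pstep_local i d4 yx).
rewrite -(nbhs_singleton (PE k.+1)); apply: near_eq_is_derive (PE k) _.
apply: der_eq (derD (tower_bstep d _ k x) (derC x _)) _; by [].
Qed.

Lemma rndDL y : rnd (y + L) = rnd y + 1.
Proof.
have := rnd_le y => /andP[r1 r2]; apply: rnd_eq; rewrite intrD mulrDr mulr1.
by apply/andP; split; lra.
Qed.

Lemma bstep_shift d c e k y : bstep d (c + e) k (y + e) = bstep d c k y.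
Proof. by rewrite /bstep opprD addrACA subrr addr0. Qed.

Lemma pstepDL d k y : pstep d k (y + L) = pstep d k y + (if k is 0%N then 1 else 0).
Proof.
rewrite /pstep rndDL intrD mulrDr mulr1 bstep_shift.
by case: k => [|k]; rewrite ?addr0// addrA.
Qed.

Lemma pstep_ge0 d y : 0 < d -> 0 <= pstep d 1%N y.
Proof. by move=> d0; rewrite /pstep addr0 bstep_ge0. Qed.

Lemma pstep_lin d y : `|pstep d 0%N y - L^-1 * y| <= 2.
Proof.
have /andP[b0 b1] := bstep01 d (L * (rnd y)%:~R) y.
have /andP[r1 r2] := rnd_le y.
have yE : L * (L^-1 * y) = y by rewrite mulVKf ?gt_eqF.
rewrite /pstep ler_norml; apply/andP; split.
  by rewrite -(ler_pM2l L0) !mulrDr !mulrN yE; nra.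
by rewrite -(ler_pM2l L0) !mulrDr !mulrN yE; nra.
Qed.

Lemma pstep_near d y : 0 < d -> pstep d 1%N y != 0 ->
  exists n : int, `|y - L * n%:~R| <= d.
Proof.
move=> d0 p0; exists (rnd y); rewrite leNgt; apply: contra p0 => yd.
by rewrite /pstep addr0 bstep_out.
Qed.

Definition lin_tower c : nat -> R -> R :=
  fun k y => if k is k'.+1 then cst_tower c k' y else c * y.

Lemma tower_lin c : tower (lin_tower c).
Proof.
case=> [|k] x; last exact: tower_cst.
by apply: der_eq (derZ c (derI x)) _; rewrite mulr1.
Qed.

(** The staircase minus its mean slope is periodic and bounded; the constant 1 / L
    carries the mass. *)
Lemma x_kernel r h d c : (r <= 2)%N -> 0 < d < L / 4 ->
  two_atoms (fun f => periodic f L) (`|h| ^+ r * (2 + L^-1))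
    (iter r (diff h) (fun y => pstep d 1%N (y - c))).
Proof.
move=> r2 d4; have V0 : 0 < L^-1 by rewrite invr_gt0.
pose T k y := pstep d k (y - c) - lin_tower L^-1 k (y - c).
have tT : tower T.
  exact: (tower_shift (- c) (towerB (tower_pstep d4) (tower_lin L^-1))).
have -> : iter r (diff h) (fun y => pstep d 1%N (y - c)) =
    iter r (diff h) (fun y => T 1%N y + cst_tower L^-1 0%N y).
  by apply: iter_diffE => y; rewrite /T subrK.
apply: (@kernel_atoms _ r h _ T (cst_tower L^-1) r2 tT (tower_cst _)).
- by move=> y; apply: le_trans (pstep_lin _ _) _; lra.
- by move=> y; case: r r2 => [|r] _ /=; rewrite ?normr0 ?gtr0_norm//; lra.
- move=> q tq qT y; apply/eqP; rewrite -subr_eq0 -iter_diff_shift -iter_diffB.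
  apply/eqP/(@tower_diff_eq0 r h (fun k y => q k (y + L) - q k y)).
    by apply: towerB => //; exact: tower_shift.
  move=> th _; rewrite -[r]addn0 qT /T /=.
  rewrite [y + _ + L - c]addrAC pstepDL.
  by rewrite !mulrDr mulVf ?gt_eqF//; ring.
move=> y; apply/eqP; rewrite -subr_eq0 -iter_diff_shift -iter_diffB.
by apply/eqP/iter_diff0 => j _; rewrite subrr.
Qed.

End Periodic.
End Step.
End Kernels.

(** * Integrals over one period of the channel *)
Section Testing.
Context {R : realType}.
Implicit Types (f g : R -> R) (v : R -> R -> R) (x y z w h a b c d e th K A B : R).
Notation lam := (@lebesgue_measure R).
(* the measurable space on which the planar Lebesgue measure lives *)
Notation lamT := (g_sigma_algebraType (R.-ocitv.-measurable)).
Notation plane := (lamT * lamT)%type.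

Variable L : R.
Hypothesis L0 : 0 < L.

Lemma measurable_Omega : measurable (Omega L : set plane).
Proof. by apply: measurableX. Qed.

Lemma lebesgue2_Omega : lebesgue2 (@Omega R L) = L%:E.
Proof.
rewrite /lebesgue2 /Omega product_measure1E//= !lebesgue_measure_itv/= !lte_fin.
by rewrite L0 ltr01 !oppr0 !adde0 -EFinM mulr1.
Qed.

Lemma continuous_measurable f : continuous f -> measurable_fun setT f.
Proof. exact: continuous_measurable_fun. Qed.

Lemma measurable_tensor (D : set (R * R)) f g :
  measurable_fun setT f -> measurable_fun setT g ->
  measurable_fun D (fun p : R * R => f p.1 * g p.2).
Proof.
move=> mf mg; apply: measurable_funTS.
by apply: measurable_funM; [exact: measurableT_comp mf measurable_fst|
  exact: measurableT_comp mg measurable_snd].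
Qed.

(** By |v| <= 1 + v^2, the measure of Omega being finite. *)
Lemma L2_integrable v : L2_Omega L v ->
  lebesgue2.-integrable (Omega L) (EFin \o (fun p : R * R => v p.1 p.2)).
Proof.
have mO := measurable_Omega.
move=> [mv nv]; apply/integrableP; split; first exact/measurable_EFinP.
have sq : (\int[lebesgue2]_(p in Omega L) (`|v p.1 p.2| ^+ 2)%:E < +oo)%E.
  move: nv; rewrite /Lnorm_on => nv; rewrite integral_mkcond.
  have := @poweR_Lnorm _ _ R lebesgue2 ((fun p : R * R => (v p.1 p.2)%:E) \_ (Omega L)) 2.
  rewrite pnatr_eq0 => /(_ isT) E; have := poweR_lty 2 nv; rewrite E.
  apply: le_lt_trans; rewrite le_eqVlt; apply/orP; left; apply/eqP.
  apply: eq_integral => p _; rewrite patchE.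
  rewrite patchE; case: ifPn => _; last by rewrite abse0 poweR0r// pnatr_eq0.
  by rewrite abse_EFin poweR_EFin powR_mulrn.
have mv2 : measurable_fun (Omega L) (fun p : R * R => `|v p.1 p.2| ^+ 2).
  apply: measurable_funX; exact: measurableT_comp mv.
apply: (@le_lt_trans _ _
  (\int[lebesgue2]_(p in Omega L) (1%:E + (`|v p.1 p.2| ^+ 2)%:E))%E).
  apply: ge0_le_integral => //=.
  - by apply/measurable_EFinP; exact: measurableT_comp mv.
  - by apply: emeasurable_funD => //; exact/measurable_EFinP.
  - move=> p _; rewrite -EFinD lee_fin; have := sqr_ge0 (`|v p.1 p.2| - 1); nra.
rewrite ge0_integralD//; last exact/measurable_EFinP.
rewrite integral_cst// mul1e lte_add_pinfty //.
by have := ltry L; rewrite -[L%:E]lebesgue2_Omega.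
Qed.

Lemma tensor_integral f g F G : continuous f -> continuous g ->
  (forall x, 0 <= f x) -> (forall x, 0 <= g x) ->
  (forall x, is_derive x 1 F (f x)) -> (forall x, is_derive x 1 G (g x)) ->
  (\int[lebesgue2]_(p in Omega L) (f p.1 * g p.2)%:E =
    ((F L - F 0) * (G 1 - G 0))%:E)%E.
Proof.
move=> cf cg f0 g0 dF dG.
have itv (h H : R -> R) b : 0 < b -> continuous h ->
    (forall x, is_derive x 1 H (h x)) ->
    (\int[lam]_(x in `[0%R, b]) (h x)%:E = (H b - H 0)%:E)%E.
  move=> b0 ch dH; apply: (continuous_FTC2 b0).
  - exact: continuous_subspaceT.
  - split=> [x _||]; first by have [] := dH x.
      by apply: cvg_at_right_filter; exact: der_continuous (dH 0).
    by apply: cvg_at_left_filter; exact: der_continuous (dH b).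
  - by move=> x _; rewrite derive1E; have [_ ->] := dH x.
rewrite integral_mkcond.
pose f1 := f \_ `[0, L]; pose g1 := g \_ `[0, 1].
have mf1 : measurable_fun setT f1.
  apply/(measurable_restrictT _ _).1 => //.
  exact: measurable_funTS (continuous_measurable cf).
have mg1 : measurable_fun setT g1.
  apply/(measurable_restrictT _ _).1 => //.
  exact: measurable_funTS (continuous_measurable cg).
have f10 x : 0 <= f1 x by rewrite /f1 patchE; case: ifP.
have g10 x : 0 <= g1 x by rewrite /g1 patchE; case: ifP.
have -> : (fun p : R * R => (f p.1 * g p.2)%:E) \_ (Omega L) =
          (fun p => (f1 p.1 * g1 p.2)%:E).
  apply/funext => -[x y]; rewrite patchE /f1 /g1 !patchE /= /Omega.
  have -> : ((x, y) \in `[0, L] `*` `[0, 1]) = (x \in `[0%R, L]) && (y \in `[0%R, 1]).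
    by apply/idP/andP; rewrite !inE.
  rewrite !mem_setE.
  by do 2 case: (_ \in _) => //=; rewrite ?mul0r ?mulr0.
rewrite fubini_tonelli1//=; last 2 first.
- by apply/measurable_EFinP; exact: measurable_tensor.
- by move=> p; rewrite lee_fin mulr_ge0.
have inner x : (\int[lam]_y (f1 x * g1 y)%:E = (f1 x)%:E * (G 1 - G 0)%:E)%E.
  under eq_integral do rewrite EFinM.
  rewrite ge0_integralZl_EFin//; last 2 first.
  - by move=> y _; rewrite lee_fin.
  - exact/measurable_EFinP.
  by rewrite -(itv g G 1 ltr01 cg dG) [in RHS]integral_mkcond restrict_EFin.
rewrite /fubini_F /=; under eq_integral do rewrite inner.
have G01 : 0 <= G 1 - G 0 by rewrite subr_ge0; apply: nondecreasing_der dG g0.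
rewrite ge0_integralZr//=; last 2 first.
- exact/measurable_EFinP.
- by move=> x _; rewrite lee_fin.
by rewrite EFinM -(itv f F L L0 cf dF) [in RHS]integral_mkcond restrict_EFin.
Qed.

End Testing.

(** * Weak derivatives against tensor products *)
Section Sobolev.
Context {R : realType}.
Implicit Types (f g : R -> R) (v : R -> R -> R) (x y z w h a b c d e th K A B : R).

Variable L : R.
Hypothesis L0 : 0 < L.

Lemma dx_tensor p g x z : tower p -> dx (fun x z => p 0%N x * g z) x z = p 1%N x * g z.
Proof.
move=> tp; rewrite /dx derive1E.
by have [_ ->] := derM (tp 0%N x) (derC x (g z)); rewrite mulr0 addr0.
Qed.

Lemma dz_tensor q f x z : tower q -> dz (fun x z => f x * q 0%N z) x z = f x * q 1%N z.
Proof.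
move=> tq; rewrite /dz derive1E.
by have [_ ->] := derZ (f x) (tq 0%N z).
Qed.

Lemma iter_dx_tensor p g i : tower p ->
  iter i dx (fun x z => p 0%N x * g z) = (fun x z => p i x * g z).
Proof.
move=> tp; elim: i => //= i ->; apply/funext => x; apply/funext => z.
by have := dx_tensor g x z (tower_tail i tp); rewrite addn0 addn1.
Qed.

Lemma iter_dz_tensor q f j : tower q ->
  iter j dz (fun x z => f x * q 0%N z) = (fun x z => f x * q j z).
Proof.
move=> tq; elim: j => //= j ->; apply/funext => x; apply/funext => z.
by have := dz_tensor f x z (tower_tail j tq); rewrite addn0 addn1.
Qed.

Lemma continuous2_tensor (D : set (R * R)) f g : continuous f -> continuous g ->
  continuous2 D (fun x z => f x * g z).
Proof.
move=> cf cg; apply: continuous_subspaceT => p; apply: cvgM.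
- by apply: continuous_comp; [exact: cvg_fst|exact: cf].
- by apply: continuous_comp; [exact: cvg_snd|exact: cg].
Qed.

Lemma Ck_tensor k p q : tower p -> tower q -> Ck_plane k (fun x z => p 0%N x * q 0%N z).
Proof.
elim: k p q => [|k IH] p q tp tq /=; (split; last split=> //).
- exact: continuous2_tensor (tower_continuous tp) (tower_continuous tq).
- exact: continuous2_tensor (tower_continuous tp) (tower_continuous tq).
- move=> x z; split.
  + by have [] := derM (tp 0%N x) (derC x (q 0%N z)).
  + by have [] := derZ (p 0%N x) (tq 0%N z).
- rewrite (_ : dx _ = fun x z => p 1%N x * q 0%N z).
    by apply: (IH (fun k => p k.+1)) => //; exact: (tower_tail 1).
  by apply/funext => x; apply/funext => z; exact: dx_tensor.
- rewrite (_ : dz _ = fun x z => p 0%N x * q 1%N z).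
    by apply: (IH p (fun k => q k.+1)) => //; exact: (tower_tail 1).
  by apply/funext => x; apply/funext => z; exact: dz_tensor.
Qed.

Lemma test_tensor p q : tower p -> tower q -> periodic (p 0%N) L ->
  supported (q 0%N) -> test_function L (fun x z => p 0%N x * q 0%N z).
Proof.
move=> tp tq pL [e e0 qe]; split=> [k|z x|].
- exact: Ck_tensor.
- by rewrite pL.
- by exists e => // x z /qe ->; rewrite mulr0.
Qed.

Definition pairing v f g : R :=
  \int[lebesgue2]_(p in Omega L) (v p.1 p.2 * (f p.1 * g p.2)).

Lemma bounded_choice (P : nat -> R -> Prop) n :
  (forall i, (i <= n)%N -> exists2 G, 0 <= G & P i G) ->
  (forall i G G', G <= G' -> P i G -> P i G') ->
  exists2 G, 0 <= G & forall i, (i <= n)%N -> P i G.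
Proof.
move=> PG Pm; elim: n PG => [|n IH] PG.
  have [G G0 PG0] := PG 0%N isT; exists G => // i; rewrite leqn0 => /eqP ->.
  exact: PG0.
have [G G0 H] := IH (fun i (le : (i <= n)%N) => PG i (leqW le)).
have [G1 G10 H1] := PG n.+1 (leqnn _); exists (G + G1); first exact: addr_ge0.
move=> i; rewrite leq_eqVlt => /predU1P[->|].
  by apply: Pm H1; rewrite lerDr.
by rewrite ltnS => /H; apply: Pm; rewrite lerDl.
Qed.

(** The weak derivatives of v take over the derivatives of the two atoms: at most 3
    in each variable, so at most 6 in all. *)
Lemma pairing_atom v m : (5 < m)%N -> Hm L m v ->
  exists2 G, 0 <= G & forall A B f g, atom (fun f => periodic f L) A f ->
    atom supported B g -> `|pairing v f g| <= G * (A * B).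
Proof.
move=> m5 [_ _ _ Dv].
pose P i j G := forall A B p q, tower p -> tower q -> periodic (p 0%N) L ->
  supported (q 0%N) -> (forall x, `|p 0%N x| <= A) -> (forall x, `|q 0%N x| <= B) ->
  `|pairing v (p i) (q j)| <= G * (A * B).
have Pm i j G G' : G <= G' -> P i j G -> P i j G'.
  move=> GG' PG A B p q tp tq pL sq pA qB; apply: le_trans (PG A B p q _ _ _ _ _ _) _ => //.
  have A0 := le_trans (normr_ge0 _) (pA 0).
  have B0 := le_trans (normr_ge0 _) (qB 0).
  by apply: ler_wpM2r => //; exact: mulr_ge0.
suff PG i j : (i + j <= m)%N -> exists2 G, 0 <= G & P i j G.
  have PG' i : (i <= 3)%N -> exists2 G, 0 <= G & forall j, (j <= 3)%N -> P i j G.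
    move=> i3; apply: bounded_choice (Pm i) => j j3; apply: PG.
    exact: leq_trans (leq_add i3 j3) m5.
  have [|G G0 GP] := bounded_choice (P := fun i G => forall j, (j <= 3)%N -> P i j G) PG'.
    by move=> i G G' GG' PG2 j /PG2; exact: Pm.
  exists G => // A B f g [i i3 [p tp [pL pA <-]]] [j j3 [q tq [qs qB <-]]].
  exact: GP.
move=> /Dv[g g2 wg]; have ig := L2_integrable L0 g2.
have mO := @measurable_Omega R L.
exists (\int[lebesgue2]_(u in Omega L) `|g u.1 u.2|).
  by apply: Rintegral_ge0.
move=> A B p q tp tq pL sq pA qB.
have := wg _ (test_tensor tp tq pL sq).
rewrite iter_dz_tensor// iter_dx_tensor// /pairing => ->.
rewrite normrM normrX normrN1 expr1n mul1r.
have mg : measurable_fun (Omega L) (fun u : R * R => g u.1 u.2) by case: g2.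
have mpq : measurable_fun (Omega L) (fun u : R * R => p 0%N u.1 * q 0%N u.2).
  by apply: measurable_tensor; apply: continuous_measurable; exact: tower_continuous.
have le u : `|g u.1 u.2 * (p 0%N u.1 * q 0%N u.2)| <= `|g u.1 u.2| * (A * B).
  by rewrite !normrM ler_wpM2l// ler_pM.
have igA : lebesgue2.-integrable (Omega L)
    (EFin \o (fun u : R * R => `|g u.1 u.2| * (A * B))).
  have := integrableZr mO (A * B) (integrable_norm ig).
  by apply: eq_integrable.
have igpq : lebesgue2.-integrable (Omega L)
    (EFin \o (fun u : R * R => g u.1 u.2 * (p 0%N u.1 * q 0%N u.2))).
  apply: le_integrable igA => //.
    by apply/measurable_EFinP; exact: measurable_funM.
  by move=> u _; rewrite lee_fin (le_trans (le u))// ler_norm.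
rewrite (le_trans (le_normr_Rintegral mO igpq))//.
rewrite -RintegralZr//; last exact: integrable_norm.
apply: le_Rintegral => //.
exact: integrable_norm.
Qed.

End Sobolev.

(** * Sobolev functions have bounded second differences *)
Section Mollification.
Context {R : realType}.
Implicit Types (f g : R -> R) (v : R -> R -> R) (x y z w h a b c d e th K A B : R).

Lemma continuous_bounded f a b : continuous f ->
  exists2 M, 0 <= M & forall x, a <= x <= b -> `|f x| <= M.
Proof.
move=> cf; have [ab|ab] := leP a b; last first.
  by exists 0 => // x /andP[ax xb]; have := le_lt_trans (le_trans ax xb) ab; rewrite ltxx.
have cnf : {within `[a, b], continuous (fun x => `|f x|)}.
  apply: within_segment => x _; apply: continuous_comp; last exact: norm_continuous.
  exact: cf.
have [c _ cmax] := EVT_max ab cnf.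
by exists `|f c| => // x xab; apply: cmax; rewrite in_itv.
Qed.

Lemma periodic_int f L x (n : int) : periodic f L -> f (x - L * n%:~R) = f x.
Proof.
move=> pf.
have pn (k : nat) y : f (y + L * k%:R) = f y.
  elim: k y => [|k IH] y; first by rewrite mulr0 addr0.
  by rewrite -natr1 mulrDr mulr1 addrA pf.
case: n => k; first by rewrite -(pn k (x - _)) subrK.
by rewrite NegzE mulrNz mulrN opprK; exact: pn.
Qed.

Variable L : R.
Hypothesis L0 : 0 < L.

Lemma pairing_integrable v f g : L2_Omega L v -> continuous f -> continuous g ->
  lebesgue2.-integrable (Omega L)
    (EFin \o (fun p : R * R => v p.1 p.2 * (f p.1 * g p.2))).
Proof.
move=> v2 cf cg; have mO := @measurable_Omega R L.
have iv := L2_integrable L0 v2.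
have [M M0 fM] := continuous_bounded 0 L cf.
have [N N0 gN] := continuous_bounded 0 1 cg.
have ivA : lebesgue2.-integrable (Omega L)
    (EFin \o (fun u : R * R => `|v u.1 u.2| * (M * N))).
  have := integrableZr mO (M * N) (integrable_norm iv).
  by apply: eq_integrable.
apply: le_integrable ivA => //.
  apply/measurable_EFinP; apply: measurable_funM; first by case: v2.
  by apply: measurable_tensor; exact: continuous_measurable.
move=> [x z] [/=]; rewrite !in_itv/= => xL z1; rewrite lee_fin !normrM normr_id.
by rewrite ler_wpM2l// ler_pM// ?(ger0_norm M0) ?(ger0_norm N0) ?fM ?gN.
Qed.

Lemma pairingDl v f1 f2 g : L2_Omega L v -> continuous f1 -> continuous f2 ->
  continuous g -> pairing L v (fun y => f1 y + f2 y) g =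
  pairing L v f1 g + pairing L v f2 g.
Proof.
move=> v2 cf1 cf2 cg; have mO := @measurable_Omega R L.
rewrite /pairing -RintegralD//; [|exact: pairing_integrable|exact: pairing_integrable].
by apply: eq_Rintegral => p _; rewrite mulrDl mulrDr.
Qed.

Lemma pairingDr v f g1 g2 : L2_Omega L v -> continuous f -> continuous g1 ->
  continuous g2 -> pairing L v f (fun y => g1 y + g2 y) =
  pairing L v f g1 + pairing L v f g2.
Proof.
move=> v2 cf1 cf2 cg; have mO := @measurable_Omega R L.
rewrite /pairing -RintegralD//; [|exact: pairing_integrable|exact: pairing_integrable].
by apply: eq_Rintegral => p _; rewrite !mulrDr.
Qed.

Lemma pairingBl v f1 f2 g : L2_Omega L v -> continuous f1 -> continuous f2 ->
  continuous g -> pairing L v (fun y => f1 y - f2 y) g =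
  pairing L v f1 g - pairing L v f2 g.
Proof.
move=> v2 cf1 cf2 cg; have mO := @measurable_Omega R L.
rewrite /pairing -RintegralB//; [|exact: pairing_integrable|exact: pairing_integrable].
by apply: eq_Rintegral => p _; rewrite mulrBl mulrBr.
Qed.

Lemma pairingBr v f g1 g2 : L2_Omega L v -> continuous f -> continuous g1 ->
  continuous g2 -> pairing L v f (fun y => g1 y - g2 y) =
  pairing L v f g1 - pairing L v f g2.
Proof.
move=> v2 cf1 cf2 cg; have mO := @measurable_Omega R L.
rewrite /pairing -RintegralB//; [|exact: pairing_integrable|exact: pairing_integrable].
by apply: eq_Rintegral => p _; rewrite !mulrBr.
Qed.

Lemma atom_continuous S A f : atom S A f -> continuous f.
Proof. by move=> [i _ [p tp [_ _ <-]]]; exact: tower_continuous. Qed.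

Lemma pairing_two_atoms m v : (5 < m)%N -> Hm L m v ->
  exists2 G, 0 <= G & forall A B f g, two_atoms (fun f => periodic f L) A f ->
    two_atoms supported B g -> `|pairing L v f g| <= G * (A * B).
Proof.
move=> m5 Hv; have [G G0 PG] := pairing_atom L0 m5 Hv.
have v2 : L2_Omega L v by case: Hv.
exists (4 * G) => [|A B f g [f1 [f2 [a1 a2 ->]]] [g1 [g2 [b1 b2 ->]]]].
  by rewrite mulr_ge0.
have [cf1 cf2] := (atom_continuous a1, atom_continuous a2).
have [cg1 cg2] := (atom_continuous b1, atom_continuous b2).
have cg : continuous (fun y => g1 y + g2 y).
  by move=> y; apply: cvgD; [exact: cg1|exact: cg2].
rewrite pairingDl// !pairingDr//.
have := PG _ _ _ _ a1 b1; have := PG _ _ _ _ a1 b2; have := PG _ _ _ _ a2 b1.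
have := PG _ _ _ _ a2 b2; rewrite !ler_norml; lra.
Qed.

Section Mollify.
Variable B : nat -> R -> R.
Hypothesis tB : tower B.
Hypothesis BN : forall x, x <= -1 -> B 0%N x = 0.
Hypothesis B1 : forall x, 1 <= x -> B 0%N x = 1.
Hypothesis Bge : forall x, 0 <= B 1%N x.
Hypothesis Bout : forall k x, 1 < `|x| -> B k.+1 x = 0.

Definition xker d c : R -> R := fun y => pstep B L d 1%N (y - c).
Definition zker d c : R -> R := bstep B d c 1%N.

Lemma xker_continuous d c : 0 < d < L / 4 -> continuous (xker d c).
Proof.
move=> d4; exact: tower_continuous (tower_shift (- c) (tower_pstep tB BN B1 Bout L0 d4)).
Qed.

Lemma zker_continuous d c : continuous (zker d c).
Proof. exact: tower_continuous (tower_bstep tB d c). Qed.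

Lemma kernel_mass d x0 z0 : 0 < d < L / 4 -> d < z0 -> z0 + d < 1 ->
  (\int[lebesgue2]_(p in Omega L) (xker d x0 p.1 * zker d z0 p.2)%:E = 1)%E.
Proof.
move=> /[dup] d4 /andP[d0 _] dz0 zd1.
have tx := tower_shift (- x0) (tower_pstep tB BN B1 Bout L0 d4).
have tz := tower_bstep tB d z0.
have E := (tensor_integral L0 (@xker_continuous d x0 d4) (@zker_continuous d z0)
  (fun x => pstep_ge0 Bge L (x - x0) d0) (fun x => bstep_ge0 Bge z0 x d0) (tx 0%N) (tz 0%N)).
set r := (X in X = _) in E; set l := (X in X = _); have -> : l = r by exact: erefl.
rewrite E.
rewrite [L + _]addrC (pstepDL _ L0) !add0r addrAC subrr add0r mul1r.
by rewrite bstep_hi ?bstep_lo ?subr0//; lra.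
Qed.

(** Concentrated kernels of mass 1 recover the values of the continuous function v;
    in x this uses the periodicity of v, the kernel being concentrated at all
    translates of x0. *)
Lemma pairing_mollify m v x0 z0 : Hm L m v -> 0 < z0 < 1 ->
  pairing L v (xker d x0) (zker d z0) @[d --> 0^'+] --> v x0 z0.
Proof.
move=> Hv /andP[z00 z01]; have [pv cv v2 _] := Hv.
have mO := @measurable_Omega R L.
apply/cvgrPdist_le => e e0.
have [dl dl0 near_v] : exists2 dl : R, 0 < dl & forall x z, `|x - x0| < dl ->
    `|z - z0| < dl -> 0 <= z <= 1 -> `|v x0 z0 - v x z| <= e.
  have : \forall p \near within channel (nbhs (x0, z0)), `|v x0 z0 - v p.1 p.2| <= e.
    have cz : channel (x0, z0) by split=> //=; rewrite in_itv/= !ltW.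
    have /cvgrPdist_le/(_ e e0) H := cv (x0, z0).
    by rewrite (nbhs_subspace_in cz); exact: H.
  move=> /nbhs_ballP[dl /= dl0 H]; exists dl => // x z xd zd z1.
  apply: (H (x, z)); first by split; rewrite /ball/= distrC.
  by split=> //=; rewrite in_itv.
near=> d.
have d0 : 0 < d by near: d; exact: nbhs_right_gt.
have dL : d < L / 4 by near: d; apply: nbhs_right_lt; rewrite divr_gt0.
have ddl : d < dl by near: d; exact: nbhs_right_lt.
have dz0 : d < z0 by near: d; exact: nbhs_right_lt.
have dz1 : d < 1 - z0 by near: d; apply: nbhs_right_lt; rewrite subr_gt0.
have d4 : 0 < d < L / 4 by rewrite d0.
have zd1 : z0 + d < 1 by lra.
have cx := @xker_continuous d x0 d4; have cz := @zker_continuous d z0.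
pose k (p : R * R) := xker d x0 p.1 * zker d z0 p.2.
have k0 p : 0 <= k p.
  by rewrite mulr_ge0// ?(pstep_ge0 Bge L _ d0) ?(bstep_ge0 Bge _ _ d0).
have ik : lebesgue2.-integrable (Omega L) (EFin \o k).
  apply/integrableP; split.
    by apply/measurable_EFinP; apply: measurable_tensor; exact: continuous_measurable.
  apply: (@le_lt_trans _ _ 1%E); last exact: ltry.
  rewrite -(kernel_mass x0 d4 dz0 zd1) le_eqVlt; apply/orP; left; apply/eqP.
  by apply: eq_integral => p _ /=; rewrite ger0_norm.
have mass : \int[lebesgue2]_(p in Omega L) k p = 1.
  by rewrite /Rintegral (kernel_mass x0 d4 dz0 zd1).
have ivk := pairing_integrable v2 cx cz.
have ick : lebesgue2.-integrable (Omega L) (EFin \o (fun p => v x0 z0 * k p)).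
  have := integrableZl mO (v x0 z0) ik; exact: eq_integrable.
have iek : lebesgue2.-integrable (Omega L) (EFin \o (fun p => e * k p)).
  have := integrableZl mO e ik; exact: eq_integrable.
have -> : v x0 z0 - pairing L v (xker d x0) (zker d z0) =
    \int[lebesgue2]_(p in Omega L) (v x0 z0 * k p - v p.1 p.2 * k p).
  by rewrite RintegralB// RintegralZl// mass mulr1.
have idk : lebesgue2.-integrable (Omega L)
    (EFin \o (fun p => v x0 z0 * k p - v p.1 p.2 * k p)).
  have := integrableB mO ick ivk; exact: eq_integrable.
apply: le_trans (le_normr_Rintegral mO idk) _.
rewrite -[leRHS]mulr1 -mass -RintegralZl//; apply: le_Rintegral => //.
  exact: integrable_norm.
move=> [x z] [/= _]; rewrite in_itv/= => z1.
rewrite -mulrBl normrM (ger0_norm (k0 _)).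
have [->|kn0] := eqVneq (k (x, z)) 0; first by rewrite !mulr0.
rewrite ler_wpM2r//.
have xk : xker d x0 x != 0 by apply: contra_neq kn0; rewrite /k /= => ->; rewrite mul0r.
have zk : zker d z0 z != 0 by apply: contra_neq kn0; rewrite /k /= => ->; rewrite mulr0.
have [n xn] := pstep_near Bout d0 xk.
rewrite -(periodic_int x n (pv z z1)); apply: near_v => //.
  by rewrite addrAC (le_lt_trans xn).
rewrite (le_lt_trans _ ddl)// leNgt; apply: contra zk => zd.
by rewrite /zker (bstep_out Bout).
Unshelve. all: by end_near. Qed.

(** Differences of the kernels in their centres become differences of v. *)
Lemma pairing_diff m v r s al h x0 z0 : Hm L m v -> 0 <= h -> 0 < z0 ->
  z0 + s%:R * h < 1 ->
  pairing L v (iter r (diff (- al)) (xker d x0)) (iter s (diff (- h)) (zker d z0))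
    @[d --> 0^'+] --> iter r (diff al) (fun x => iter s (diff h) (v x) z0) x0.
Proof.
move=> Hv h0 z00 z01; have v2 : L2_Omega L v by case: Hv.
have tx d x : 0 < d < L / 4 -> tower (fun k y => pstep B L d k (y - x)).
  by move=> d4; exact: tower_shift (- x) (tower_pstep tB BN B1 Bout L0 d4).
have cX r' d x : 0 < d < L / 4 -> continuous (iter r' (diff (- al)) (xker d x)).
  by move=> d4; exact: (tower_continuous (k := 1) (tower_diff (- al) r' (tx d x d4))).
have cZ s' d z : continuous (iter s' (diff (- h)) (zker d z)).
  exact: (tower_continuous (k := 1) (tower_diff (- h) s' (tower_bstep tB d z))).
have shX r' d x : iter r' (diff (- al)) (xker d (x + al)) =
    fun y => iter r' (diff (- al)) (xker d x) (y - al).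
  apply/funext => y; rewrite -iter_diff_shift; congr (iter _ _ _ y).
  by apply/funext => w; rewrite /xker opprD addrA addrAC.
have shZ s' d z : iter s' (diff (- h)) (zker d (z + h)) =
    fun y => iter s' (diff (- h)) (zker d z) (y - h).
  apply/funext => y; rewrite -iter_diff_shift; congr (iter _ _ _ y).
  by apply/funext => w; rewrite /zker -(bstep_shift B d z h _ (w - h)) subrK.
have cS f c : continuous f -> continuous (fun y => f (y - c)).
  move=> cf y; apply: (@continuous_comp _ _ _ (fun y => y - c) f); last exact: cf.
  exact: der_continuous (derB (derI y) (derC y c)).
have small : \forall d \near (0:R)^'+, 0 < d < L / 4.
  near=> d; apply/andP; split; near: d; first exact: nbhs_right_gt.
  by apply: nbhs_right_lt; rewrite divr_gt0.
have stepZ s' z x : 0 < z -> z + s'%:R * h < 1 ->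
    pairing L v (xker d x) (iter s' (diff (- h)) (zker d z)) @[d --> 0^'+] -->
    iter s' (diff h) (v x) z.
  elim: s' z => [|s' IH] z zp zq /=.
    by apply: (pairing_mollify Hv); rewrite zp -[z]addr0 -(mul0r h) zq.
  move: zq; rewrite -natr1 mulrDl mul1r => zq.
  have s'h : 0 <= s'%:R * h by rewrite mulr_ge0.
  have c1 : z + h + s'%:R * h < 1 by lra.
  have c2 : z + s'%:R * h < 1 by lra.
  have cv : pairing L v (xker d x) (iter s' (diff (- h)) (zker d (z + h))) -
      pairing L v (xker d x) (iter s' (diff (- h)) (zker d z)) @[d --> 0^'+] -->
      iter s'.+1 (diff h) (v x) z.
    by apply: cvgB; apply: IH => //; exact: ltr_wpDr.
  apply: (cvg_trans _ cv); apply: near_eq_cvg; near=> d.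
  have d4 : 0 < d < L / 4 by near: d.
  rewrite /diff -/(diff (- h)) /= shZ -[LHS]pairingBr//; first exact: xker_continuous.
  by apply: cS; exact: cZ.
elim: r x0 => [|r IH] x0 /=; first exact: stepZ.
pose psi d := iter s (diff (- h)) (zker d z0).
have cv : pairing L v (iter r (diff (- al)) (xker d (x0 + al))) (psi d) -
    pairing L v (iter r (diff (- al)) (xker d x0)) (psi d) @[d --> 0^'+] -->
    iter r.+1 (diff al) (fun x => iter s (diff h) (v x) z0) x0.
  by apply: cvgB; exact: IH.
apply: (cvg_trans _ cv); apply: near_eq_cvg; near=> d.
have d4 : 0 < d < L / 4 by near: d.
rewrite /= shX -[LHS]pairingBl//.
- by apply: cS; exact: cX.
- exact: cX.
- exact: cZ.
Unshelve. all: by end_near. Qed.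

End Mollify.

(** Bounded differences of order at most 2, uniformly in the open strip.  This
    quantitative form of C^{1,1} is the only regularity of the data used later; it
    passes to limits of mollifications. *)
Definition tame K v := forall r s al h x z, (r + s <= 2)%N -> 0 <= h <= 8^-1 ->
  0 < z -> z + s%:R * h < 1 ->
  `|iter r (diff al) (fun x => iter s (diff h) (v x) z) x| <= K * (`|al| ^+ r * h ^+ s).

(** The kernel bounds do not depend on the width d, so they survive d -> 0. *)
Lemma Hm_tame m v : (5 < m)%N -> Hm L m v -> exists2 K, 0 <= K & tame K v.
Proof.
move=> m5 Hv; have [B tB [BN B1 Bge Bout]] := @smooth_step R.
have [G G0 PG] := pairing_two_atoms m5 Hv.
have [A A0 zk] := z_kernel tB BN B1 Bge Bout.
exists (G * ((2 + L^-1) * A)).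
  by rewrite !mulr_ge0// addr_ge0// invr_ge0 ltW.
move=> r s al h x z rs h8 z0 z1; have /andP[h0 _] := h8.
have r2 := leq_trans (leq_addr s r) rs; have s2 := leq_trans (leq_addl r s) rs.
have cv := pairing_diff tB BN B1 Bge Bout (r := r) (al := al) (x0 := x) Hv h0 z0 z1.
apply: (@closed_cvg _ _ _ _ _ (fun u : R => u <= G * ((2 + L^-1) * A) *
  (`|al| ^+ r * h ^+ s)) (@closed_le R _) _ _ (cvg_norm cv)).
near=> d.
have d0 : 0 < d by near: d; exact: nbhs_right_gt.
have dL : d < L / 4 by near: d; apply: nbhs_right_lt; rewrite divr_gt0.
have dz : d < z by near: d; exact: nbhs_right_lt.
have dz1 : d < 1 - (z + s%:R * h) by near: d; apply: nbhs_right_lt; rewrite subr_gt0.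
apply: (le_trans (PG (`|- al| ^+ r * (2 + L^-1)) (h ^+ s * A) _ _ _ _)).
- apply: x_kernel => //; last by rewrite d0.
- by apply: zk => //; lra.
by rewrite normrN; lra.
Unshelve. all: by end_near. Qed.

End Mollification.

(** * Smooth forcing has bounded second differences *)
Section Smooth.
Context {R : realType}.
Implicit Types (f g : R -> R) (v : R -> R -> R) (F G : R -> R -> R -> R).
Implicit Types (x y z w h a b c d e t th K A B L T : R).

(** At an interior point the restriction of the increments to the interval is
    vacuous near 0. *)
Lemma derive_on_interior f z : 0 < z < 1 -> derivable_on `[0, 1] f z ->
  is_derive z 1 f (derive_on `[0, 1] f z).
Proof.
move=> /andP[z0 z1].
have near01 : \forall e \near (0:R)^', `[0, 1]%classic (e + z).
  apply: cvg_within; near=> e; rewrite /= in_itv/=.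
  have ez : `|e| < Num.min z (1 - z).
    near: e; apply: (@nbhs0_lt R R^o); by rewrite lt_min z0 subr_gt0 z1.
  move: ez; rewrite lt_min => /andP[/ltr_normlP[e1 e2] /ltr_normlP[e3 e4]].
  by apply/andP; split; lra.
have E : within [set e | `[0, 1]%classic (e + z)] (0:R)^' = (0:R)^'.
  apply/funext => P; apply/propext; split; last exact: cvg_within.
  by rewrite /within/= => H; move: near01; apply: filterS2 H => e /[apply].
rewrite /derivable_on /derive_on E => df.
have qE : (fun e => e^-1 *: (f (e + z) - f z)) = (fun e : R => e^-1 *: (f (e *: 1 + z) - f z)).
  by apply/funext => e; rewrite [e *: 1]mulr1.
split; first by rewrite /derivable -qE.
by rewrite /derive -qE.
Unshelve. all: by end_near. Qed.

Definition Dx F : R -> R -> R -> R := fun t => dx (F t).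
Definition Dz F : R -> R -> R -> R := fun t x z => derive_on `[0, 1] (F t x) z.

Lemma Ck_continuous T k F : Ck_cylinder T k F -> continuous3 (cylinder T) F.
Proof. by case: k => [|k] []. Qed.

Lemma Ck_Dx T k F : Ck_cylinder T k.+1 F -> Ck_cylinder T k (Dx F).
Proof. by case=> _ []. Qed.

Lemma Ck_Dz T k F : Ck_cylinder T k.+1 F -> Ck_cylinder T k (Dz F).
Proof. by case=> _ []. Qed.

Lemma Ck_is_derive T k F t x z : Ck_cylinder T k.+1 F -> 0 <= t <= T -> 0 < z < 1 ->
  is_derive x 1 (F t ^~ z) (Dx F t x z) /\ is_derive z 1 (F t x) (Dz F t x z).
Proof.
move=> [_ [H _ _ _]] tT z01; have [|_ Hx Hz] := H t x z.
  split; [split=> //|]; rewrite /= in_itv//=.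
  by case/andP: z01 => /ltW -> /ltW ->.
split; last exact: derive_on_interior.
by rewrite /Dx /dx derive1E; exact: derivableP.
Qed.

Definition xperiodic T L F := forall t x z, 0 <= t <= T -> 0 < z < 1 ->
  F t (x + L) z = F t x z.

Lemma Dx_periodic T k L F : Ck_cylinder T k.+1 F -> xperiodic T L F ->
  xperiodic T L (Dx F).
Proof.
move=> CF pF t x z tT z01.
have [d1 _] := Ck_is_derive (x + L) CF tT z01.
have [d2 _] := Ck_is_derive x CF tT z01.
have /der_unique := der_shift d1; apply.
by under eq_fun do rewrite pF//.
Qed.

Lemma Dz_periodic T k L F : Ck_cylinder T k.+1 F -> xperiodic T L F ->
  xperiodic T L (Dz F).
Proof.
move=> CF pF t x z tT z01.
have [_ d1] := Ck_is_derive (x + L) CF tT z01.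
have [_ d2] := Ck_is_derive x CF tT z01.
apply: (der_unique d1); apply: near_eq_is_derive d2.
have /andP[z0 z1] := z01; near=> w.
rewrite pF//; apply/andP; split; near: w.
- exact: lt_nbhsr z0.
- exact: lt_nbhsl z1.
Unshelve. all: by end_near. Qed.

Lemma xperiodic_bounded T L F : 0 < L -> 0 <= T -> continuous3 (cylinder T) F ->
  xperiodic T L F ->
  exists2 K, 0 <= K & forall t x z, 0 <= t <= T -> 0 < z < 1 -> `|F t x z| <= K.
Proof.
move=> L0 T0 cF pF.
pose D : set (R * R * R) := `[0, T] `*` `[0, L] `*` `[0, 1].
have cD : {within D, continuous (fun p : R * R * R => `|F p.1.1 p.1.2 p.2|)}.
  have cD : {within D, continuous (fun p : R * R * R => F p.1.1 p.1.2 p.2)}.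
    by apply: continuous_subspaceW cF => -[[t x] z] [[? ?] ?].
  by move=> p; apply: continuous_comp; [exact: cD|exact: norm_continuous].
have [||c _ cmax] := compact_EVT_max _ _ cD.
- by exists (0, 0, 0); split; [split|]; rewrite /= in_itv/= lexx ?ler01 ?(ltW L0).
- by apply: compact_setX; [apply: compact_setX|]; exact: segment_compact.
exists `|F c.1.1 c.1.2 c.2| => // t x z tT z01.
pose n := Num.floor (x / L).
have pz : periodic (F t ^~ z) L by move=> w; exact: pF.
rewrite -[F t x z](periodic_int x n pz).
have := floor_itv (x / L); rewrite -/n intrD => /andP[n1 n2].
have xE : x = L * (x / L) by rewrite mulrC divfK ?gt_eqF.
rewrite -(ler_pM2l L0) in n1; rewrite -(ltr_pM2l L0) in n2.
apply: (cmax (t, x - L * n%:~R, z)).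
rewrite inE /D; split; [split|] => /=; rewrite in_itv//=; last first.
  by case/andP: z01 => /ltW -> /ltW ->.
by apply/andP; split; lra.
Qed.

Lemma iter_diff_param s h (g g' : R -> R -> R) x z :
  (forall j, (j <= s)%N -> is_derive x 1 (fun x => g x (z + j%:R * h)) (g' x (z + j%:R * h))) ->
  is_derive x 1 (fun x => iter s (diff h) (g x) z) (iter s (diff h) (g' x) z).
Proof.
elim: s z => [|s IH] z H /=; first by have := H 0%N isT; rewrite mul0r addr0.
apply: derB; apply: IH => j js; last exact/H/leqW.
by have := H j.+1 js; rewrite -natr1 mulrDl mul1r addrA addrAC.
Qed.

(** The differences in x are estimated first and those in z afterwards, so that
    only derivatives taken in this order occur, without exchange of partial
    derivatives. *)
Lemma smooth_tame T L F : 0 < L -> 0 <= T -> smooth_cylinder T F ->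
  xperiodic T L F -> exists2 K, 0 <= K & forall t, 0 <= t <= T -> tame K (F t).
Proof.
move=> L0 T0 sF pF.
pose G r s := iter s Dz (iter r Dx F).
have CG r s k : Ck_cylinder T k (G r s).
  rewrite /G; elim: s k => [|s IH] k /=; last exact: Ck_Dz.
  by elim: r k => [|r IH] k /=; [exact: sF|exact: Ck_Dx].
have pG r s : xperiodic T L (G r s).
  rewrite /G; elim: s => [|s IH]; last by apply: (Dz_periodic (k := 0)) => //; exact: (CG r s 1%N).
  elim: r => [//|r IH]; apply: (Dx_periodic (k := 0)) => //; exact: (CG r 0%N 1%N).
have bG r s : exists2 K, 0 <= K &
    forall t x z, 0 <= t <= T -> 0 < z < 1 -> `|G r s t x z| <= K.
  apply: xperiodic_bounded L0 T0 _ (pG r s); exact: (Ck_continuous (CG r s 0%N)).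
pose P r s K := forall t x z, 0 <= t <= T -> 0 < z < 1 -> `|G r s t x z| <= K.
have Pm r s K K' : K <= K' -> P r s K -> P r s K'.
  by move=> KK PK t x z tT z01; apply: le_trans KK; exact: PK.
have [||K K0 PK] := @bounded_choice R (fun r K => forall s, (s <= 2)%N -> P r s K) 2.
- by move=> r _; apply: bounded_choice (Pm r) => s _; exact: bG.
- by move=> r K K' KK PK s /PK; exact: Pm.
exists K => // t tT r s al h x z rs /andP[h0 h8] z0 z1.
have r2 := leq_trans (leq_addr s r) rs; have s2 := leq_trans (leq_addl r s) rs.
have zth th : 0 <= th <= s%:R -> 0 < z + th * h < 1.
  move=> /andP[th0 ths]; have t1 : 0 <= th * h by rewrite mulr_ge0.
  have t2 : th * h <= s%:R * h by rewrite ler_wpM2r.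
  by apply/andP; split; lra.
rewrite mulrCA.
apply: (@diff_le _ r (fun k x => iter s (diff h) (G k 0%N t x) z)) => [k th _ _|th _].
  apply: iter_diff_param => j js.
  have [] := Ck_is_derive (x + th * al) (CG k 0%N 1%N) tT (zth j%:R _) => //.
  by rewrite ler0n ler_nat.
have -> : K * h ^+ s = `|h| ^+ s * K by rewrite (ger0_norm h0) mulrC.
apply: (@diff_le _ s (fun k => G r k t (x + th * al))) => [k th' _ /zth z01|th' /zth z01].
  by have [] := Ck_is_derive (x + th * al) (CG r k 1%N) tT z01.
exact: PK.
Qed.

End Smooth.

(** * Consequences of bounded differences *)
Section EulerBounds.
Context {R : realType}.
Implicit Types (f g : R -> R) (v : R -> R -> R) (F G : R -> R -> R -> R).
Implicit Types (x y z w h al c d e t s th K A B L T : R).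

Section Tame.
Variables (K : R) (v : R -> R -> R).
Hypothesis K0 : 0 <= K.
Hypothesis tv : tame K v.

Lemma tame_bound x z : 0 < z < 1 -> `|v x z| <= K.
Proof.
move=> /andP[z0 z1]; have := @tv 0%N 0%N 0 0 x z isT.
rewrite /= !expr0 !mulr1 mul0r addr0; apply => //.
by rewrite lexx invr_ge0 ler0n.
Qed.

Lemma tame_x al x z : 0 < z < 1 -> `|v (x + al) z - v x z| <= K * `|al|.
Proof.
move=> /andP[z0 z1]; have := @tv 1%N 0%N al 0 x z isT.
rewrite /= /diff expr1 expr0 !mulr1 mul0r addr0; apply => //.
by rewrite lexx invr_ge0 ler0n.
Qed.

Lemma tame_xx al x z : 0 < z < 1 ->
  `|v (x + al) z + v (x - al) z - 2 * v x z| <= K * al ^+ 2.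
Proof.
move=> /andP[z0 z1]; have := @tv 2%N 0%N al 0 (x - al) z isT.
rewrite /= /diff expr0 mulr1 mul0r addr0 subrK real_normK ?num_real//.
have -> : v (x + al) z - v x z - (v x z - v (x - al) z) =
  v (x + al) z + v (x - al) z - 2 * v x z by ring.
by apply => //; rewrite lexx invr_ge0 ler0n.
Qed.

Lemma tame_z h x z : 0 <= h <= 8^-1 -> 0 < z -> z + h < 1 ->
  `|v x (z + h) - v x z| <= K * h.
Proof.
move=> h8 z0 z1; have := @tv 0%N 1%N 0 h x z isT.
by rewrite /= /diff expr1 expr0 !mul1r; apply.
Qed.

Lemma tame_xz al h x z : 0 <= h <= 8^-1 -> 0 < z -> z + h < 1 ->
  `|v (x + al) (z + h) - v (x + al) z - (v x (z + h) - v x z)| <= K * (`|al| * h).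
Proof.
move=> h8 z0 z1; have := @tv 1%N 1%N al h x z isT.
by rewrite /= /diff !expr1 !mul1r; apply.
Qed.

Lemma tame_zz h x z : 0 <= h <= 8^-1 -> 0 < z - h -> z + h < 1 ->
  `|v x (z + h) + v x (z - h) - 2 * v x z| <= K * h ^+ 2.
Proof.
move=> h8 z0 z1; have := @tv 0%N 2%N 0 h x (z - h) isT.
rewrite /= /diff expr0 mul1r subrK.
have -> : v x (z + h) - v x z - (v x z - v x (z - h)) =
  v x (z + h) + v x (z - h) - 2 * v x z by ring.
by apply => //; lra.
Qed.

(** The characteristics through neighbouring lines z - h, z, z + h start from
    different x; here A and B measure the first and second differences of these
    starting points.  The second difference of v splits into two mixed differences,
    one pure difference in each variable, and a first difference in x. *)
Lemma tame_joint A B h x xp xm z : 0 <= A -> 0 <= h <= 8^-1 ->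
  0 < z - h -> z + h < 1 ->
  `|xp - x| <= A * h -> `|xp + xm - 2 * x| <= B * h ^+ 2 ->
  `|v xp (z + h) + v xm (z - h) - 2 * v x z| <=
    K * (1 + 2 * A + A ^+ 2 + B) * h ^+ 2.
Proof.
move=> A0 h8 z0 z1 xpA xmB; have /andP[h0 _] := h8.
pose al := xp - x.
have E1 := @tame_xz al h x z h8 _ z1.
have E2 := @tame_xz (- al) h x (z - h) h8 z0 _; rewrite subrK in E2.
have E3 := @tame_zz h x z h8 z0 z1.
have E4 := @tame_xx al x z _.
have E5 := @tame_x (xm - (x - al)) (x - al) (z - h) _.
have xpE : x + al = xp by rewrite /al; ring.
have xmE : x - al + (xm - (x - al)) = xm by ring.
rewrite xpE in E1 E4; rewrite xmE in E5; rewrite normrN in E2.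
have E6 : xm - (x - al) = xp + xm - 2 * x by rewrite /al; ring.
rewrite E6 in E5.
have alh : K * (`|al| * h) <= K * A * h ^+ 2.
  by rewrite -mulrA ler_wpM2l// expr2 mulrA ler_wpM2r.
have al2 : K * al ^+ 2 <= K * A ^+ 2 * h ^+ 2.
  rewrite -mulrA ler_wpM2l// -exprMn -real_normK ?num_real//.
  by rewrite lerXn2r ?nnegrE ?mulr_ge0.
have xm2 : K * `|xp + xm - 2 * x| <= K * B * h ^+ 2.
  by rewrite -mulrA ler_wpM2l.
have z0' : 0 < z by lra. have z1' : z < 1 by lra. have z1'' : z - h < 1 by lra.
have /ler_normlP[a1 a2] := le_trans (E1 z0') alh.
have /ler_normlP[b1 b2] := le_trans (E2 z1') alh.
have /ler_normlP[c1 c2] := E3.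
have z01 : 0 < z < 1 by rewrite z0'.
have /ler_normlP[d1 d2] := le_trans (E4 z01) al2.
have zh01 : 0 < z - h < 1 by rewrite z0.
have /ler_normlP[e1 e2] := le_trans (E5 zh01) xm2.
by rewrite ler_norml; apply/andP; split; lra.
Qed.

End Tame.

Lemma continuous3_eps (D : set (R * R * R)) F t x z e : continuous3 D F ->
  D (t, x, z) -> 0 < e ->
  exists2 d, 0 < d & forall t' x' z', D (t', x', z') -> `|t' - t| < d ->
    `|x' - x| < d -> `|z' - z| < d -> `|F t' x' z' - F t x z| <= e.
Proof.
move=> cF Dp e0.
have : \forall p \near within D (nbhs (t, x, z)), `|F t x z - F p.1.1 p.1.2 p.2| <= e.
  have /cvgrPdist_le/(_ e e0) H := cF (t, x, z).
  by rewrite (nbhs_subspace_in Dp); exact: H.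
move=> /nbhs_ballP[d /= d0 H]; exists d => // t' x' z' D' td xd zd.
rewrite distrC; apply: (H (t', x', z')) => //.
by split; [split|]; rewrite /ball/= distrC.
Qed.

Lemma within_eps f a b : (forall x e, a <= x <= b -> 0 < e ->
    exists2 d, 0 < d & forall y, a <= y <= b -> `|y - x| < d -> `|f y - f x| <= e) ->
  {within `[a, b], continuous f}.
Proof.
move=> H; rewrite continuous_subspace_in => x /set_mem xin.
have xab : a <= x <= b by move: xin; rewrite /= in_itv.
apply/cvgrPdist_le => e e0.
suff : \forall y \near within `[a, b] (nbhs x), `|f x - f y| <= e.
  by rewrite (nbhs_subspace_in xin).
have [d d0 dP] := H x e xab e0.
apply/nbhs_ballP; exists d => //= y; rewrite /ball/= distrC => yd yab.
by rewrite distrC; apply: dP => //; move: yab; rewrite in_itv.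
Qed.

End EulerBounds.

(** * Differentiation along curves *)
Section Characteristics.
Context {R : realType}.
Implicit Types (f g : R -> R) (v : R -> R -> R) (F G : R -> R -> R -> R).
Implicit Types (x y z w h al c d e t s th K A B L T : R).

Lemma within_along T F (X : R -> R) z b : continuous3 (cylinder T) F ->
  0 <= z <= 1 -> b <= T -> continuous X ->
  {within `[0, b], continuous (fun s => F s (X s) z)}.
Proof.
move=> cF z01 bT cX; apply: within_eps => s e /andP[s0 sb] e0.
have cyl s' x' : 0 <= s' <= b -> cylinder T (s', x', z).
  move=> /andP[? ?]; split; [split=> //|]; rewrite /= in_itv//=.
  by apply/andP; split => //; exact: le_trans bT.
have [|d d0 dP] := continuous3_eps cF (cyl s (X s) _) e0; first by rewrite s0.
have /cvgrPdist_lt/(_ d d0)/nbhs_ballP[d1 /= d10 d1P] := cX s.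
exists (Num.min d d1) => [|y yb]; first by rewrite lt_min d0.
rewrite lt_min => /andP[yd yd1]; apply: dP => //; first exact: cyl.
- by rewrite distrC; apply: d1P; rewrite /ball/= distrC.
- by rewrite subrr normr0.
Qed.

(** The increment is split into a step in x at the new time, controlled by the
    continuity of the x-derivative, and a step in time at the old x. *)
Lemma der_along v vx s0 (X : R -> R) Dt X' d0 :
  is_derive s0 1 (fun s => v s (X s0)) Dt -> is_derive s0 1 X X' -> 0 < d0 ->
  (forall s x, `|s - s0| < d0 -> is_derive x 1 (v s) (vx s x)) ->
  (forall e, 0 < e -> exists2 d, 0 < d & forall s x, `|s - s0| < d ->
     `|x - X s0| < d -> `|vx s x - vx s0 (X s0)| <= e) ->
  is_derive s0 1 (fun s => v s (X s)) (Dt + X' * vx s0 (X s0)).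
Proof.
move=> dt0 dX d00 dv cv; apply/der_epsP => e e0.
set q := vx s0 (X s0).
pose M := `|X'| + 1; pose N := `|q| + 1.
have M0 : 0 < M by rewrite ltr_wpDl.
have N0 : 0 < N by rewrite ltr_wpDl.
have [d1 d10 P1] := cv (e / (3 * M)) (divr_gt0 e0 (mulr_gt0 (ltr0n R 3) M0)).
have e2 : 0 < Num.min 1 (e / (3 * N)).
  by rewrite lt_min ltr01 divr_gt0// mulr_gt0.
have [d2 d20 P2] := (der_epsP _ _ _).1 dX _ e2.
have e3 : 0 < e / 3 by rewrite divr_gt0.
have [d3 d30 P3] := (der_epsP _ _ _).1 dt0 _ e3.
exists (Num.min (Num.min d0 d1) (Num.min (d1 / M) (Num.min d2 d3))).
  by rewrite !lt_min d00 d10 d20 d30 divr_gt0.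
move=> h; rewrite !lt_min => /andP[/andP[hd0 hd1] /and3P[hdM hd2 hd3]].
have := P2 h hd2; set k := X (s0 + h) - X s0 => kP.
have {P3}E3 := P3 h hd3.
have h0 := normr_ge0 h.
have kM : `|k| <= M * `|h|.
  have -> : k = (k - X' * h) + X' * h by ring.
  rewrite (le_trans (ler_normD _ _))// normrM.
  have : Num.min 1 (e / (3 * N)) * `|h| <= 1 * `|h|.
    by rewrite ler_wpM2r// ge_min lexx.
  by rewrite /M; lra.
have kd1 : `|k| < d1.
  by rewrite (le_lt_trans kM)// mulrC -ltr_pdivlMr.
have hs : `|s0 + h - s0| = `|h| by congr `|_|; ring.
have E1 : `|v (s0 + h) (X (s0 + h)) - v (s0 + h) (X s0) - q * k| <= e / (3 * M) * `|k|.
  pose g th := v (s0 + h) (k * th + X s0) - q * k * th.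
  have dg th : is_derive th 1 g (k * vx (s0 + h) (k * th + X s0) - q * k).
    apply: der_eq (derB (der_affine (dv _ (k * th + X s0) _)) (derZ (q * k) (derI th))) _.
    - by rewrite hs.
    - by rewrite mulr1.
  have kE : X (s0 + h) = k * 1 + X s0 by rewrite /k; ring.
  have -> : v (s0 + h) (X (s0 + h)) - v (s0 + h) (X s0) - q * k = g 1 - g 0.
    by rewrite kE /g mulr0 add0r; ring.
  rewrite -[leRHS]mulr1 -[X in _ * X]subr0.
  apply: (mvt_le ler01 (fun th _ => dg th)).
    by apply: within_segment => th _; exact: der_continuous (dg th).
  move=> th /andP[th0 th1].
  rewrite [q * k]mulrC -mulrBr normrM mulrC ler_wpM2r//; apply: P1; first by rewrite hs.
  rewrite addrK normrM (le_lt_trans _ kd1)// -[leRHS]mulr1 ler_wpM2l//.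
  by rewrite ger0_norm ltW.
have -> : v (s0 + h) (X (s0 + h)) - v s0 (X s0) - (Dt + X' * q) * h =
    (v (s0 + h) (X (s0 + h)) - v (s0 + h) (X s0) - q * k) + q * (k - X' * h)
    + (v (s0 + h) (X s0) - v s0 (X s0) - Dt * h) by ring.
have t1 : e / (3 * M) * `|k| <= e / 3 * `|h|.
  rewrite invfM mulrA -mulrA ler_wpM2l ?divr_ge0 ?(ltW e0)//.
  by rewrite mulrC ler_pdivrMr// mulrC.
have t2 : `|q * (k - X' * h)| <= e / 3 * `|h|.
  rewrite normrM (le_trans (ler_wpM2l _ kP))// mulrA ler_wpM2r//.
  apply: (@le_trans _ _ (N * (e / (3 * N)))).
    apply: ler_pM => //; [by rewrite le_min ler01 divr_ge0 ?(ltW e0)// mulr_ge0 ?(ltW N0)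
      |by rewrite lerDl|by rewrite ge_min lexx orbT].
  have -> // : N * (e / (3 * N)) = e / 3 by field; rewrite gt_eqF.
have := ler_normD (v (s0 + h) (X (s0 + h)) - v (s0 + h) (X s0) - q * k + q * (k - X' * h))
  (v (s0 + h) (X s0) - v s0 (X s0) - Dt * h).
have := ler_normD (v (s0 + h) (X (s0 + h)) - v (s0 + h) (X s0) - q * k) (q * (k - X' * h)).
lra.
Qed.

End Characteristics.

(** * Regularity of the inviscid solution by characteristics *)
Section Euler.
Context {R : realType}.
Implicit Types (f g : R -> R) (v : R -> R -> R) (F G : R -> R -> R -> R).
Implicit Types (x y z w h al c d e t s th A B : R).

Lemma within_iter_diff (s : nat) h v z b :
  (forall j, (j <= s)%N -> {within `[0, b], continuous (fun t => v t (z + j%:R * h))}) ->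
  {within `[0, b], continuous (fun t => iter s (diff h) (v t) z)}.
Proof.
elim: s z => [|s IH] z H /=; first by have := H 0%N isT; rewrite mul0r addr0.
move=> t; apply: cvgB; last by apply: IH => j js; exact/H/leqW.
apply: (IH (z + h)) => j js.
by have := H j.+1 js; rewrite -natr1 mulrDl mul1r addrA addrAC.
Qed.

Variables (L T : R) (a : R -> R) (b : R -> R -> R) (f1 : R -> R -> R)
  (f2 : R -> R -> R -> R) (v1 : R -> R -> R) (v2 : R -> R -> R -> R).
Hypothesis T0 : 0 < T.
Hypothesis euler : euler_solution L T a b f1 f2 v1 v2.
Variable K : R.
Hypothesis K0 : 0 <= K.
Hypothesis ta : tame K (fun _ z => a z).
Hypothesis tb : tame K b.
Hypothesis tf1 : forall t, 0 <= t <= T -> tame K (const_x f1 t).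
Hypothesis tf2 : forall t, 0 <= t <= T -> tame K (f2 t).

Lemma open_cyl t x z : 0 < t < T -> 0 < z < 1 -> open_cylinder T (t, x, z).
Proof. by move=> tT z01; split; [split=> //|]; rewrite /= in_itv. Qed.

Lemma euler_v1_der t z : 0 < t < T -> 0 < z < 1 ->
  is_derive t 1 (v1 ^~ z) (f1 t z).
Proof.
move=> tT z01; have [[_ dv _] _ _ eq] := euler.
have op := open_cyl 0 tT z01; have [dv1 _] := dv _ _ _ op.
by have [<- _] := eq _ _ _ op; rewrite /dt derive1E; exact: derivableP.
Qed.

Lemma euler_v1_within z c : 0 <= z <= 1 -> c <= T ->
  {within `[0, c], continuous (fun t => v1 t z)}.
Proof.
move=> z01 cT; have [[cv _ _] _ _ _] := euler.
have := within_along (X := fun _ => 0) cv z01 cT; apply.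
by move=> x; exact: cvg_cst.
Qed.

(** v1 is a plus the time integral of f1, and differences in z commute with the
    integral. *)
Lemma euler_v1_tame t : 0 <= t <= T -> tame (K * (1 + T)) (const_x v1 t).
Proof.
move=> /andP[t0 tT] r s al h x z rs h8 z0 z1; have /andP[h0 _] := h8.
have T1 : 0 <= T by exact: ltW.
case: r rs => [|r] rs; last first.
  rewrite (_ : iter r.+1 _ _ _ = 0) ?normr0; last first.
    elim: {rs} r x => [|r IH] x; first by rewrite /= /diff subrr.
    by rewrite iterS /diff !IH subrr.
  by rewrite !mulr_ge0 ?exprn_ge0 ?addr_ge0.
rewrite /= expr0 mul1r.
have zj j : (j <= s)%N -> 0 < z + j%:R * h < 1.
  move=> js; have t1 : 0 <= j%:R * h by rewrite mulr_ge0.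
  have t2 : j%:R * h <= s%:R * h by rewrite ler_wpM2r// ler_nat.
  by apply/andP; split; lra.
pose V t := iter s (diff h) (v1 t) z.
have Vt : `|V t - V 0| <= K * h ^+ s * (t - 0).
  apply: (mvt_le (df := fun t => iter s (diff h) (f1 t) z) t0).
  - move=> w /andP[w0 wt]; apply: iter_diff_param => j js.
    by apply: euler_v1_der (zj j js); rewrite w0 (lt_le_trans wt).
  - apply: within_iter_diff => j /zj /andP[zj0 zj1].
    by apply: euler_v1_within => //; rewrite !ltW.
  - move=> w /andP[w0 wt]; have wT : 0 <= w <= T by rewrite (ltW w0) (ltW (lt_le_trans wt tT)).
    have := @tf1 w wT 0%N s 0 h 0 z rs h8 z0 z1; by rewrite /= expr0 mul1r.
have V0 : `|V 0| <= K * h ^+ s.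
  have -> : V 0 = iter s (diff h) a z.
    rewrite /V; have [_ _ [_ ini _] _] := euler.
    have {ini} : forall j, (j <= s)%N -> v1 0 (z + j%:R * h) = a (z + j%:R * h).
      by move=> j /zj /andP[zj0 zj1]; apply: ini; rewrite !ltW.
    clear -R; elim: s z => [|s IH] z H /=; first by have := H 0%N isT; rewrite mul0r addr0.
    rewrite /diff (IH z) => [|j js]; last exact/H/leqW.
    rewrite (IH (z + h)) // => j js.
    by have := H j.+1 js; rewrite -natr1 mulrDl mul1r addrA addrAC.
  by have := @ta 0%N s 0 h 0 z rs h8 z0 z1; rewrite /= expr0 mul1r.
rewrite -/(V t) (_ : V t = V 0 + (V t - V 0)); last by ring.
rewrite (le_trans (ler_normD _ _))//.
have : K * h ^+ s * (t - 0) <= K * h ^+ s * T.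
  by rewrite ler_wpM2l ?subr0// mulr_ge0// exprn_ge0.
lra.
Qed.

Lemma displacement z : 0 < z < 1 -> exists A : R -> R,
  (continuous A) /\ forall t, 0 <= t <= T -> is_derive t 1 A (v1 t z).
Proof.
move=> /andP[z0 z1].
(* Extending v1 by constants outside [0, T] makes the primitive differentiable at
   the end points as well. *)
pose clamp t := Num.max 0 (Num.min t T).
have cl t : 0 <= clamp t <= T.
  by rewrite /clamp le_max lexx/= ge_max ge_min lexx orbT andbT ltW.
have z01 : 0 <= z <= 1 by rewrite !ltW.
have cv : continuous (fun t => v1 (clamp t) z).
  move=> t; apply/cvgrPdist_le => e e0.
  have [[cv _ _] _ _ _] := euler.
  have cyl s : cylinder T (clamp s, 0, z) by split; [split=> //|]; rewrite /= in_itv//= cl.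
  have [d d0 dP] := continuous3_eps cv (cyl t) e0.
  apply/nbhs_ballP; exists d => //= s; rewrite /ball/= => sd.
  rewrite distrC; apply: (dP (clamp s) 0 z (cyl s)); rewrite ?subrr ?normr0//.
  apply: le_lt_trans sd; rewrite /clamp.
  have T1 := ltW T0.
  have n1 := ler_norm (t - s); have n2 := ler_norm (s - t); rewrite [in leRHS]distrC in n2.
  set N := `|t - s| in n1 n2 *.
  have cE u : Num.max 0 (Num.min u T) = if u <= 0 then 0 else if T <= u then T else u.
    have [u0|u0] := leP u 0; first by apply: max_l; rewrite ge_min u0.
    have [uT|uT] := leP T u; first by rewrite max_r// ltW.
    by rewrite max_r// ltW.
  by rewrite !cE ler_norml; apply/andP; split;
    do ![case: ifPn; rewrite -?ltNge => ?]; lra.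
have [A dA] := primitive_exists cv; exists A; split.
  by move=> t; exact: der_continuous (dA t).
move=> t /andP[t0 tT]; have := dA t; rewrite /clamp (min_idPl tT) (max_idPr t0).
by [].
Qed.

Definition is_displacement z (A : R -> R) :=
  continuous A /\ forall t, 0 <= t <= T -> is_derive t 1 A (v1 t z).

Lemma along_der z (A : R -> R) c t : 0 < z < 1 -> is_displacement z A ->
  0 < t < T -> is_derive t 1 (fun s => v2 s (c + A s) z) (f2 t (c + A t) z).
Proof.
move=> z01 [cA dA] tT; have [_ [_ dv [_ cvx]] _ eq] := euler.
have /andP[t0 t1] := tT.
have [_ <-] := eq _ (c + A t) _ (open_cyl (c + A t) tT z01).
have dX : is_derive t 1 (fun s => c + A s) (v1 t z).
  by apply: der_eq (derD (derC t c) (dA t _)) _; rewrite ?add0r// !ltW.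
have der s x : 0 < s < T -> derivable (fun s => v2 s x z) s 1 /\
    is_derive x 1 (v2 s ^~ z) (dx (v2 s) x z).
  move=> sT; have [d1 d2] := dv _ _ _ (open_cyl x sT z01).
  by split; [exact: d1|exact: (der_derive1 d2)].
apply: (@der_along R (fun s x => v2 s x z) (fun s x => dx (v2 s) x z) t
  (fun s => c + A s) _ (v1 t z) (Num.min t (T - t))) => //.
- by have [d1 _] := der t (c + A t) tT; rewrite /dt derive1E; exact: derivableP.
- by rewrite lt_min t0 subr_gt0.
- move=> s x; rewrite lt_min => /andP[/ltr_normlP[s1 s2] /ltr_normlP[s3 s4]].
  by have [] := der s x; first by apply/andP; split; lra.
move=> e e0.
have [d d0 dP] := continuous3_eps cvx (open_cyl (c + A t) tT z01) e0.
exists (Num.min d (Num.min t (T - t))); first by rewrite !lt_min d0 t0 subr_gt0.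
move=> s x; rewrite !lt_min => /and3P[sd /ltr_normlP[s1 s2] /ltr_normlP[s3 s4]].
move=> /andP[xd _]; apply: dP; rewrite ?subrr ?normr0//.
by apply: open_cyl => //; apply/andP; split; lra.
Qed.

Lemma along_within z (A : R -> R) c t : 0 < z < 1 -> is_displacement z A ->
  t <= T -> {within `[0, t], continuous (fun s => v2 s (c + A s) z)}.
Proof.
move=> /andP[z0 z1] [cA _] tT; have [_ [cv _ _] _ _] := euler.
apply: (within_along (X := fun s => c + A s) cv) => //; first by rewrite !ltW.
by move=> s; apply: cvgD; [exact: cvg_cst|exact: cA].
Qed.

(** Along a characteristic v2 has time derivative f2, so a bound on a combination
    of the data, taken on three characteristics, passes to the solution.  Differences
    of the solution are then controlled without differentiating it twice. *)
Lemma transported_combination (c1 c2 c3 z1 z2 z3 x1 x2 x3 : R) (A1 A2 A3 : R -> R) t M :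
  0 < z1 < 1 -> 0 < z2 < 1 -> 0 < z3 < 1 ->
  is_displacement z1 A1 -> is_displacement z2 A2 -> is_displacement z3 A3 ->
  0 <= t <= T ->
  (forall s, 0 <= s <= t -> `|c1 * f2 s (x1 + A1 s) z1 + c2 * f2 s (x2 + A2 s) z2
     + c3 * f2 s (x3 + A3 s) z3| <= M) ->
  `|c1 * b (x1 + A1 0) z1 + c2 * b (x2 + A2 0) z2 + c3 * b (x3 + A3 0) z3| <= M ->
  `|c1 * v2 t (x1 + A1 t) z1 + c2 * v2 t (x2 + A2 t) z2 + c3 * v2 t (x3 + A3 t) z3|
    <= M * (1 + T).
Proof.
move=> i1 i2 i3 d1 d2 d3 /andP[t0 tT] fM bM.
pose V s := c1 * v2 s (x1 + A1 s) z1 + c2 * v2 s (x2 + A2 s) z2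
  + c3 * v2 s (x3 + A3 s) z3.
have Vt : `|V t - V 0| <= M * (t - 0).
  apply: (mvt_le t0 (df := fun s => c1 * f2 s (x1 + A1 s) z1 +
    c2 * f2 s (x2 + A2 s) z2 + c3 * f2 s (x3 + A3 s) z3)).
  - move=> s /andP[s0 st]; have sT : 0 < s < T by rewrite s0 (lt_le_trans st).
    by apply: derD; [apply: derD|]; apply: derZ; exact: along_der.
  - have cw (c z x : R) (A : R -> R) : 0 < z < 1 -> is_displacement z A ->
        {within `[0, t], continuous (fun s => c * v2 s (x + A s) z)}.
      by move=> z01 dA s; apply: cvgM; [exact: cvg_cst|exact: (@along_within z A x t z01 dA tT s)].
    by move=> s; apply: cvgD; [apply: cvgD|]; exact: cw.
  - by move=> s /andP[s0 st]; apply: fM; rewrite !ltW.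
have V0 : `|V 0| <= M.
  have [_ _ [_ _ ini] _] := euler.
  by rewrite /V !ini//; [case/andP: i3|case/andP: i2|case/andP: i1] => u w; rewrite !ltW.
have M0 : 0 <= M := le_trans (normr_ge0 _) bM.
rewrite -/(V t) (_ : V t = V 0 + (V t - V 0)); last by ring.
rewrite (le_trans (ler_normD _ _))//.
have : M * (t - 0) <= M * T by rewrite ler_wpM2l ?subr0.
lra.
Qed.

Lemma euler_v2_bound t x z : 0 <= t <= T -> 0 < z < 1 -> `|v2 t x z| <= K * (1 + T).
Proof.
move=> tT z01; have [A dA] := displacement z01.
have := @transported_combination 1 0 0 z z z (x - A t) 0 0 A A A t K z01 z01 z01 dA dA dA tT.
have e (p q r : R) : 1 * p + 0 * q + 0 * r = p by ring.
rewrite !e subrK; apply.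
- move=> s /andP[s0 st]; rewrite e; apply: tame_bound => //.
  by apply: tf2; rewrite s0 (le_trans st)//; case/andP: tT.
- exact: tame_bound.
Qed.

Lemma euler_v2_x t x al z : 0 <= t <= T -> 0 < z < 1 ->
  `|v2 t (x + al) z - v2 t x z| <= K * (1 + T) * `|al|.
Proof.
move=> tT z01; have [A dA] := displacement z01.
have := @transported_combination 1 (-1) 0 z z z (x - A t + al) (x - A t) 0 A A A t
  (K * `|al|) z01 z01 z01 dA dA dA tT.
have e (p q r : R) : 1 * p + -1 * q + 0 * r = p - q by ring.
have sh s : x - A t + al + A s = x - A t + A s + al by ring.
rewrite !e !sh subrK mulrAC; apply.
- move=> s /andP[s0 st]; rewrite e sh; apply: tame_x => //.
  by apply: tf2; rewrite s0 (le_trans st)//; case/andP: tT.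
- exact: tame_x.
Qed.

Lemma euler_v2_xx t x al z : 0 <= t <= T -> 0 < z < 1 ->
  `|v2 t (x + al) z + v2 t (x - al) z - 2 * v2 t x z| <= K * (1 + T) * al ^+ 2.
Proof.
move=> tT z01; have [A dA] := displacement z01.
have := @transported_combination 1 1 (-2) z z z (x - A t + al) (x - A t - al) (x - A t)
  A A A t (K * al ^+ 2) z01 z01 z01 dA dA dA tT.
have e (p q r : R) : 1 * p + 1 * q + -2 * r = p + q - 2 * r by ring.
have sh1 s : x - A t + al + A s = x - A t + A s + al by ring.
have sh2 s : x - A t - al + A s = x - A t + A s - al by ring.
rewrite !e !sh1 !sh2 subrK mulrAC; apply.
- move=> s /andP[s0 st]; rewrite e sh1 sh2; apply: tame_xx => //.
  by apply: tf2; rewrite s0 (le_trans st)//; case/andP: tT.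
- exact: tame_xx.
Qed.

(** Size of the distortion of the characteristics across neighbouring lines. *)
Definition distortion : R := K * (1 + T) * T.

(** The three characteristics that arrive at (x, z - h), (x, z) and (x, z + h) spread
    at most like the differences of v1 in z, integrated in time. *)
Lemma euler_v2_zz t x h z : 0 <= t <= T -> 0 <= h <= 8^-1 -> 0 < z - h -> z + h < 1 ->
  `|v2 t x (z + h) + v2 t x (z - h) - 2 * v2 t x z| <=
    K * (1 + 2 * distortion + distortion ^+ 2 + distortion) * (1 + T) * h ^+ 2.
Proof.
move=> /[dup] tT /andP[t0 t1] h8 z0 z1; have /andP[h0 _] := h8.
have zp : 0 < z + h < 1 by apply/andP; split; lra.
have zm : 0 < z - h < 1 by apply/andP; split; lra.
have zc : 0 < z < 1 by apply/andP; split; lra.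
have [Ap dAp] := displacement zp; have [Am dAm] := displacement zm.
have [A dA] := displacement zc.
have T1 := ltW T0.
have D0 : 0 <= distortion by rewrite /distortion !mulr_ge0 ?addr_ge0.
have KT0 : 0 <= K * (1 + T) by rewrite mulr_ge0 ?addr_ge0.
have tv1 s : 0 <= s <= T -> tame (K * (1 + T)) (const_x v1 s) by exact: euler_v1_tame.
have der s : 0 <= s <= T -> [/\ is_derive s 1 Ap (v1 s (z + h)),
    is_derive s 1 Am (v1 s (z - h)) & is_derive s 1 A (v1 s z)].
  by move=> sT; split; [exact: dAp.2|exact: dAm.2|exact: dA.2].
have bound (G g : R -> R) M s : 0 <= s <= t -> 0 <= M ->
    (forall w, 0 <= w <= T -> is_derive w 1 G (g w)) ->
    (forall w, 0 <= w <= T -> `|g w| <= M) -> `|G s - G t| <= M * T.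
  move=> /andP[s0 st] M0 dG gM.
  have wT w : s <= w <= t -> 0 <= w <= T.
    by move=> /andP[w0 w1]; rewrite (le_trans s0)// (le_trans w1).
  rewrite distrC; apply: (@le_trans _ _ (M * (t - s))).
    apply: (mvt_le (df := g) st) => [w /andP[w0 w1]||w /andP[w0 w1]].
    - by apply: dG; apply: wT; rewrite !ltW.
    - by apply: within_segment => w /wT /dG; exact: der_continuous.
    - by apply: gM; apply: wT; rewrite !ltW.
  by rewrite ler_wpM2l//; lra.
have first s : 0 <= s <= t -> `|(x - Ap t + Ap s) - (x - A t + A s)| <= distortion * h.
  move=> st; have -> : (x - Ap t + Ap s) - (x - A t + A s) =
    (Ap s - A s) - (Ap t - A t) by ring.
  have -> : distortion * h = K * (1 + T) * h * T by rewrite /distortion; ring.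
  apply: (bound (fun s => Ap s - A s) (fun s => v1 s (z + h) - v1 s z)) => //.
  - by rewrite mulr_ge0.
  - by move=> w /der[dp _ dc]; exact: derB.
  - move=> w wT; apply: (tame_z (v := const_x v1 w) (tv1 w wT) 0 h8); first by lra.
    by [].
have second s : 0 <= s <= t ->
    `|(x - Ap t + Ap s) + (x - Am t + Am s) - 2 * (x - A t + A s)| <=
    distortion * h ^+ 2.
  move=> st; have -> : (x - Ap t + Ap s) + (x - Am t + Am s) - 2 * (x - A t + A s) =
    (Ap s + Am s - 2 * A s) - (Ap t + Am t - 2 * A t) by ring.
  have -> : distortion * h ^+ 2 = K * (1 + T) * h ^+ 2 * T by rewrite /distortion; ring.
  apply: (bound (fun s => Ap s + Am s - 2 * A s)
    (fun s => v1 s (z + h) + v1 s (z - h) - 2 * v1 s z)) => //.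
  - by rewrite mulr_ge0 ?exprn_ge0.
  - by move=> w /der[dp dm dc]; exact: derB (derD dp dm) (derZ 2 dc).
  - by move=> w wT; exact: (tame_zz (v := const_x v1 w) (tv1 w wT) 0 h8 z0 z1).
have := @transported_combination 1 1 (-2) (z + h) (z - h) z
  (x - Ap t) (x - Am t) (x - A t) Ap Am A t
  (K * (1 + 2 * distortion + distortion ^+ 2 + distortion) * h ^+ 2)
  zp zm zc dAp dAm dA tT.
have e (p q r : R) : 1 * p + 1 * q + -2 * r = p + q - 2 * r by ring.
rewrite !e !subrK [_ * h ^+ 2 * (1 + T)]mulrAC; apply.
- move=> s st; rewrite e; apply: tame_joint => //; [|exact: first|exact: second].
  by apply: tf2; case/andP: st => s0 st; rewrite s0 (le_trans st).
- have z00 : 0 <= (0 : R) <= t by apply/andP.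
  by apply: tame_joint => //; [exact: first|exact: second].
Qed.

End Euler.

(** * A comparison principle *)
Section Comparison.
Context {R : realType}.
Implicit Types (f g : R -> R) (x y z w h al c d e t s th K A B M N : R).

Lemma closed_strip_bound T (F : R -> R -> R -> R) t x z K : continuous3 (cylinder T) F ->
  0 <= t <= T -> (forall z, 0 < z < 1 -> `|F t x z| <= K) -> 0 <= z <= 1 ->
  `|F t x z| <= K.
Proof.
move=> cF tT FK /andP[z0 z1]; apply/ler_addgt0Pr => e e0.
have cyl w : 0 <= w <= 1 -> cylinder T (t, x, w).
  by move=> w01; split; [split=> //|]; rewrite /= in_itv.
have [|d d0 dP] := continuous3_eps cF (cyl z _) e0; first by rewrite z0.
pose q := Num.min 2^-1 d.
have q0 : 0 < q by rewrite lt_min d0 invr_gt0 ltr0n.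
have qd : q <= d by rewrite ge_min lexx orbT.
have q2 : q <= 2^-1 by rewrite ge_min lexx.
pose w := z + q * (2^-1 - z).
have w01 : 0 < w < 1 by rewrite /w; apply/andP; split; nra.
have : `|F t x w - F t x z| <= e.
  apply: dP; rewrite ?subrr ?normr0//.
  - by apply: cyl; case/andP: w01 => /ltW -> /ltW ->.
  - by rewrite /w addrAC subrr add0r ltr_norml; apply/andP; split; nra.
have := FK _ w01; rewrite !ler_norml => /andP[a1 a2] /andP[b1 b2].
by apply/andP; split; lra.
Qed.

(** Otherwise f would lie above a steeper parabola near x. *)
Lemma second_der_le f (f' : R -> R) c x d K : 0 < d ->
  (forall y, `|y - x| < d -> is_derive y 1 f (f' y)) -> is_derive x 1 f' c ->
  (forall h, 0 < h < d -> f (x + h) + f (x - h) - 2 * f x <= K * h ^+ 2) -> c <= K.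
Proof.
move=> d0 df df' fK; rewrite leNgt; apply/negP => Kc.
pose e := (c - K) / 4; have e0 : 0 < e by rewrite divr_gt0// subr_gt0.
have [d1 d10 P1] := (der_epsP _ _ _).1 df' e e0.
pose h := Num.min d d1 / 2.
have h0 : 0 < h by rewrite divr_gt0// lt_min d0.
have hd : h < d /\ h < d1.
  by have : Num.min d d1 <= d /\ Num.min d d1 <= d1; [rewrite !ge_min !lexx orbT|
    rewrite /h => -[]; split; lra].
have [{}hd hd1] := hd.
have itv_oo_cc th : 0 < th < h -> 0 <= th <= h by move=> /andP[/ltW -> /ltW ->].
pose g th := f (1 * th + x) + f (-1 * th + x) - (c - e) * th ^+ 2.
have dg th : 0 <= th <= h -> is_derive th 1 g
    (1 * f' (1 * th + x) + -1 * f' (-1 * th + x) - (c - e) * (2 * th ^+ 1 * 1)).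
  move=> /andP[t0 th1]; apply: derB; last by apply: derZ; exact: (derX 2 (derI th)).
  apply: derD; apply: der_affine; apply: df.
  - by rewrite addrK mul1r ger0_norm//; lra.
  - by rewrite addrK mulN1r normrN ger0_norm//; lra.
have dg' th (th0 : 0 < th < h) := dg th (itv_oo_cc th th0).
have [|xi /andP[x0 xh] E] := mvt h0 dg'.
  by apply: within_segment => th /dg; exact: der_continuous.
have := P1 xi; have := P1 (- xi); rewrite normrN ger0_norm ?(ltW x0)// => H1 H2.
have /ler_normlP[a1 a2] := H1 (lt_trans xh hd1).
have /ler_normlP[b1 b2] := H2 (lt_trans xh hd1).
have := fK h; rewrite h0 hd => /(_ isT).
have g0E : g 0 = 2 * f x by rewrite /g mul1r mulN1r oppr0 !add0r expr0n /=; ring.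
have ghE : g h = f (x + h) + f (x - h) - (c - e) * h ^+ 2.
  by rewrite /g mul1r mulN1r ![_ + x]addrC.
move: E; rewrite g0E ghE subr0 !mul1r !mulN1r mulr1 expr1 ![_ + x]addrC => E.
have : 0 <= (f' (x + xi) - f' (x - xi) - (c - e) * (2 * xi)) * h.
  by rewrite mulr_ge0 ?(ltW h0)//; nra.
rewrite -E => E1 E2.
have : (c - e - K) * h ^+ 2 <= 0 by lra.
by rewrite leNgt mulr_gt0 ?exprn_gt0//; rewrite /e; lra.
Qed.

Lemma der_left_max f t a d : 0 < d -> is_derive t 1 f a ->
  (forall s, t - d < s < t -> f s <= f t) -> 0 <= a.
Proof.
move=> d0 fa ft; rewrite leNgt; apply/negP => a0.
have e0 : 0 < - a / 2 by lra.
have [d1 d10 P] := (der_epsP _ _ _).1 fa _ e0.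
pose h := Num.min d d1 / 2.
have h0 : 0 < h by rewrite divr_gt0// lt_min d0.
have [hd hd1] : h < d /\ h < d1.
  by have : Num.min d d1 <= d /\ Num.min d d1 <= d1; [rewrite !ge_min !lexx orbT|
    rewrite /h => -[]; split; lra].
have := P (- h); rewrite normrN (ger0_norm (ltW h0)) => /(_ hd1) /ler_normlP[b1 b2].
have hh : t - d < t - h < t by apply/andP; split; lra.
have := ft _ hh; nra.
Qed.

Lemma der_max f t a : is_derive t 1 f a -> (forall s, f s <= f t) -> a = 0.
Proof.
move=> fa ft; apply/eqP; rewrite eq_le; apply/andP; split; last first.
  exact: (der_left_max ltr01 fa).
have fa' : is_derive (- t) 1 (fun s => f (-1 * s + 0)) (-1 * a).
  by apply: der_affine; rewrite mulN1r opprK addr0.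
suff : 0 <= -1 * a by lra.
apply: (der_left_max ltr01 fa') => s _ /=.
by rewrite [-1 * - t]mulN1r opprK !addr0.
Qed.

Section Principle.
Variables (L T nu1 nu3 M N sg : R) (u v f : R -> R -> R -> R) (c c' : R -> R -> R).
Variables (psi psit psiz psizz : R -> R -> R).
Hypothesis L0 : 0 < L.
Hypothesis T0 : 0 < T.
Hypothesis nu10 : 0 <= nu1.
Hypothesis nu30 : 0 <= nu3.
Hypothesis sg1 : `|sg| = 1.
Hypothesis regu : parabolic_regular T u.
Hypothesis contv : continuous3 (cylinder T) v.
Hypothesis derv : forall t x z, open_cylinder T (t, x, z) ->
  derivable (fun s => v s x z) t 1 /\ derivable (v t ^~ z) x 1.
Hypothesis peru : forall t z, 0 <= t <= T -> 0 <= z <= 1 -> periodic (u t ^~ z) L.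
Hypothesis perv : forall t z, 0 <= t <= T -> 0 <= z <= 1 -> periodic (v t ^~ z) L.
Hypothesis equ : forall t x z, open_cylinder T (t, x, z) ->
  dt u t x z + c t z * dx (u t) x z - nu1 * dx (dx (u t)) x z
  - nu3 * dz (dz (u t)) x z = f t x z.
Hypothesis eqv : forall t x z, open_cylinder T (t, x, z) ->
  dt v t x z + c' t z * dx (v t) x z = f t x z.
Hypothesis dxv : forall t x z, open_cylinder T (t, x, z) -> `|dx (v t) x z| <= N.
Hypothesis dxxv : forall t x z h, open_cylinder T (t, x, z) ->
  `|v t (x + h) z + v t (x - h) z - 2 * v t x z| <= M * h ^+ 2.
Hypothesis dzzv : forall t x z h, open_cylinder T (t, x, z) -> 0 <= h <= 8^-1 ->
  0 < z - h -> z + h < 1 ->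
  `|v t x (z + h) + v t x (z - h) - 2 * v t x z| <= M * h ^+ 2.
Hypothesis cpsi : continuous3 (cylinder T) (const_x psi).
Hypothesis psi_t : forall t z, is_derive t 1 (psi ^~ z) (psit t z).
Hypothesis psi_z : forall t z, is_derive z 1 (psi t) (psiz t z).
Hypothesis psi_zz : forall t z, is_derive z 1 (psiz t) (psizz t z).
Hypothesis super : forall t z, 0 < t < T -> 0 < z < 1 ->
  `|c t z - c' t z| * N + (nu1 + nu3) * M <= psit t z - nu3 * psizz t z.
Hypothesis initial : forall x z, 0 <= z <= 1 -> sg * (u 0 x z - v 0 x z) <= psi 0 z.
Hypothesis boundary : forall t x z, 0 <= t <= T -> z = 0 \/ z = 1 ->
  sg * (u t x z - v t x z) <= psi t z.

(** At an interior maximum of W, second differences of u are at most those of v and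
    psi together; this bounds the second derivatives of u from above although v has
    none.  The equation for u then contradicts the supersolution inequality, made
    strict by the term e t. *)
Lemma no_interior_max e t x z : 0 < e -> 0 < t < T -> 0 < z < 1 ->
  let W t x z := sg * (u t x z - v t x z) - psi t z - e * t in
  (forall s, 0 <= s <= t -> W s x z <= W t x z) ->
  (forall y, W t y z <= W t x z) ->
  (forall w, 0 <= w <= 1 -> W t x w <= W t x z) -> False.
Proof.
move=> e0 tT z01 W Wt Wx Wz; have /andP[z0 z1] := z01; have /andP[t0 t1] := tT.
have op y w : 0 < w < 1 -> open_cylinder T (t, y, w) by exact: open_cyl.
have [_ du _] := regu.
have [dvt dvx] := derv (op x _ z01).
have [dut dux duxx duz duzz] := du _ _ _ (op x _ z01).
have absg p q : `|p| <= q -> sg * p <= q /\ - (sg * p) <= q.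
  move=> pq; have /ler_normlP[] : `|sg * p| <= q by rewrite normrM sg1 mul1r.
  by split.
have Et : 0 <= sg * (dt u t x z - dt v t x z) - psit t z - e.
  have d1 : is_derive t 1 (fun s => u s x z) (dt u t x z) := der_derive1 dut.
  have d2 : is_derive t 1 (fun s => v s x z) (dt v t x z) := der_derive1 dvt.
  have dW := derB (derB (derZ sg (derB d1 d2)) (psi_t t z)) (derZ e (derI t)).
  rewrite mulr1 in dW; apply: (der_left_max t0 dW) => s /andP[s0 st].
  by apply: Wt; rewrite subrr in s0; rewrite !ltW.
have du1 y w : 0 < w < 1 -> is_derive y 1 (u t ^~ w) (dx (u t) y w).
  by move=> w01; have [_ H _ _ _] := du _ _ _ (op y w w01); exact: der_derive1 H.
have dv1 : is_derive x 1 (v t ^~ z) (dx (v t) x z) := der_derive1 dvx.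
have duxx1 : is_derive x 1 (dx (u t) ^~ z) (dx (dx (u t)) x z) := der_derive1 duxx.
have duzz1 : is_derive z 1 (dz (u t) x) (dz (dz (u t)) x z) := der_derive1 duzz.
have Ex : sg * (dx (u t) x z - dx (v t) x z) = 0.
  have := derB (derZ sg (derB (du1 x z z01) dv1)) (derC x (psi t z + e * t)).
  rewrite subr0 => /der_max; apply => y.
  by have := Wx y; rewrite /W; lra.
have Exx : sg * dx (dx (u t)) x z <= M.
  apply: (@second_der_le (fun y => sg * u t y z) (fun y => sg * dx (u t) y z)
    _ x 1 M ltr01 (fun y _ => derZ sg (du1 y z z01)) (derZ sg duxx1)).
  move=> h _; have [a1 _] := absg _ _ (dxxv h (op x z z01)).
  by have := Wx (x + h); have := Wx (x - h); rewrite /W; lra.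
have Ezz : sg * dz (dz (u t)) x z - psizz t z <= M.
  pose d := Num.min 8^-1 (Num.min z (1 - z)).
  have d0 : 0 < d by rewrite !lt_min z0 subr_gt0 z1 invr_gt0 ltr0n.
  have [dz8 [dz0 dz1]] : d <= 8^-1 /\ d <= z /\ d <= 1 - z.
    by rewrite /d !ge_min !lexx !orbT.
  have dzu w : `|w - z| < d -> is_derive w 1 (fun w => sg * u t x w - psi t w)
      (sg * dz (u t) x w - psiz t w).
    move=> /ltr_normlP[w1 w2]; have w01 : 0 < w < 1 by apply/andP; split; lra.
    have [_ _ _ H _] := du _ _ _ (op x w w01).
    exact: (derB (derZ sg (der_derive1 H)) (psi_z t w)).
  apply: (second_der_le d0 dzu (derB (derZ sg duzz1) (psi_zz t z))).
  move=> h /andP[h0 hd].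
  have h8 : 0 <= h <= 8^-1 by apply/andP; split; lra.
  have zh0 : 0 < z - h by lra.
  have zh1 : z + h < 1 by lra.
  have [a1 _] := absg _ _ (dzzv (op x z z01) h8 zh0 zh1).
  have zp : 0 <= z + h <= 1 by apply/andP; split; lra.
  have zm : 0 <= z - h <= 1 by apply/andP; split; lra.
  by have := Wz _ zp; have := Wz _ zm; rewrite /W; lra.
have sup := super tT z01.
have N0 := dxv (op x z z01).
have bN : `|(c t z - c' t z) * dx (v t) x z| <= `|c t z - c' t z| * N.
  by rewrite normrM ler_wpM2l.
have [b1 b2] := absg _ _ bN.
have E1 := equ (op x z z01); have E2 := eqv (op x z z01).
have F1 := ler_wpM2l nu10 Exx; have F2 := ler_wpM2l nu30 Ezz.
have F3 : c t z * (sg * (dx (u t) x z - dx (v t) x z)) = 0 by rewrite Ex mulr0.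
have F4 : sg * (dt u t x z + c t z * dx (u t) x z - nu1 * dx (dx (u t)) x z
  - nu3 * dz (dz (u t)) x z) = sg * (dt v t x z + c' t z * dx (v t) x z).
  by rewrite E1 E2.
lra.
Qed.

(** The maximum over one period of x and over times up to t < T exists by
    compactness; the sign sg yields the upper and the lower bound. *)
Theorem comparison t x z : 0 <= t < T -> 0 <= z <= 1 ->
  sg * (u t x z - v t x z) <= psi t z.
Proof.
move=> /andP[t0 tT] z01; have T1 := ltW T0.
apply/ler_addgt0Pr => e e0.
pose k := e / T; have k0 : 0 < k by rewrite divr_gt0.
pose W t x z := sg * (u t x z - v t x z) - psi t z - k * t.
suff : W t x z <= 0.
  have : k * t <= e by rewrite /k mulrAC ler_pdivrMr// ler_wpM2l// ltW.
  by rewrite /W; lra.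
pose D : set (R * R * R) := `[0, t] `*` `[0, L] `*` `[0, 1].
have DS : D `<=` cylinder T.
  move=> [[s y] w] [[/= s1 _] w1]; split; [split=> //|exact: w1].
  by move: s1; rewrite /= !in_itv/= => /andP[-> /le_trans] -> //; exact: ltW.
have cW : {within D, continuous (fun p : R * R * R => W p.1.1 p.1.2 p.2)}.
  have [cu _ _] := regu.
  apply: (continuous_subspaceW DS) => p.
  apply: cvgB; [apply: cvgB; [apply: cvgM; [exact: cvg_cst|apply: cvgB; [exact: cu|
    exact: contv]]|exact: cpsi]|].
  apply: cvgM; first exact: cvg_cst.
  have cfst : continuous (fun p : R * R * R => p.1.1).
    by move=> q; apply: (@continuous_comp _ _ _ fst fst); exact: cvg_fst.
  exact: (continuous_subspaceT cfst).
have [||m min mmax] := compact_EVT_max _ _ cW.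
- by exists (0, 0, 0); split; [split|]; rewrite /= in_itv/= lexx ?ler01 ?(ltW L0).
- by apply: compact_setX; [apply: compact_setX|]; exact: segment_compact.
have maxW s y w : 0 <= s <= t -> 0 <= w <= 1 -> W s y w <= W m.1.1 m.1.2 m.2.
  move=> st w01; have sT : 0 <= s <= T.
    by case/andP: st => -> /le_trans; apply; exact: ltW.
  pose n := Num.floor (y / L).
  have -> : W s y w = W s (y - L * n%:~R) w.
    by rewrite /W (periodic_int y n (peru sT w01)) (periodic_int y n (perv sT w01)).
  have := floor_itv (y / L); rewrite -/n intrD => /andP[n1 n2].
  have yE : y = L * (y / L) by rewrite mulrC divfK ?gt_eqF.
  rewrite -(ler_pM2l L0) in n1; rewrite -(ltr_pM2l L0) in n2.
  apply: (mmax (s, y - L * n%:~R, w)); rewrite inE /D.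
  split; [split|] => /=; rewrite in_itv//=.
  by apply/andP; split; lra.
apply: le_trans (maxW t x z _ z01) _; first by rewrite t0 lexx.
move: m min {mmax} maxW => [[s y] w]; rewrite inE => -[[/= st _] w1] maxW.
move: st w1; rewrite /= !in_itv/= => st w01; have /andP[s0 s1] := st.
have sT : 0 <= s <= T by rewrite s0 (le_trans s1)// ltW.
rewrite leNgt; apply/negP => Wpos.
have ks : 0 <= k * s by rewrite mulr_ge0// ltW.
have [s00|s00] := eqVneq s 0.
  move: Wpos; rewrite s00 /W; have := initial y w01; lra.
have [w0|w0] := eqVneq w 0.
  move: Wpos; rewrite /W; have := boundary y sT (or_introl w0); lra.
have [w1|w1] := eqVneq w 1.
  move: Wpos; rewrite /W; have := boundary y sT (or_intror w1); lra.
have sp : 0 < s < T by rewrite lt_def s00 s0 (le_lt_trans s1).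
have wp : 0 < w < 1.
  by case/andP: w01 => a b; rewrite lt_def w0 a /= lt_def eq_sym w1.
apply: (@no_interior_max k s y w k0 sp wp).
- by move=> r /andP[r0 rs]; apply: maxW => //; rewrite r0 (le_trans rs).
- by move=> r; exact: maxW.
- by move=> r r01; exact: maxW.
Qed.

End Principle.
End Comparison.

(** * Boundary layer barriers *)
Section Barrier.
Context {R : realType}.
Implicit Types (f g : R -> R) (x y z w h c d e t s th K A B M N p q r : R).

(** Boundary layers of width 1 / s at both walls, eigenfunctions of the second
    derivative for the eigenvalue s^2. *)
Definition layers s z : R := expR (- s * z) + expR (s * (z - 1)).
Definition layers' s z : R := - s * expR (- s * z) + s * expR (s * (z - 1)).

Lemma der_exp_affine c d z : is_derive z 1 (fun z => expR (c * z + d)) (c * expR (c * z + d)).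
Proof. by apply: (der_affine (f := expR)); exact: is_derive_expR. Qed.

Lemma layersE s z : layers s z = expR (- s * z + 0) + expR (s * z + - s).
Proof. by rewrite /layers addr0 mulrBr mulr1. Qed.

Lemma layers'E s z : layers' s z = - s * expR (- s * z + 0) + s * expR (s * z + - s).
Proof. by rewrite /layers' addr0 mulrBr mulr1. Qed.

Lemma layers_der s z : is_derive z 1 (layers s) (layers' s z).
Proof.
rewrite layers'E (_ : layers s = fun z => expR (- s * z + 0) + expR (s * z + - s)).
  by apply: derD; exact: der_exp_affine.
by apply/funext => w; exact: layersE.
Qed.

Lemma layers'_der s z : is_derive z 1 (layers' s) (s ^+ 2 * layers s z).
Proof.
have -> : layers' s = fun z => - s * expR (- s * z + 0) + s * expR (s * z + - s).
  by apply/funext => w; exact: layers'E.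
apply: der_eq (derD (derZ (- s) (der_exp_affine _ _ z)) (derZ s (der_exp_affine _ _ z))) _.
by rewrite layersE; ring.
Qed.

Lemma layers_ge0 s z : 0 <= layers s z.
Proof. by rewrite addr_ge0 ?expR_ge0. Qed.

Lemma layers_wall s z : z = 0 \/ z = 1 -> 1 <= layers s z.
Proof.
by move=> [->|->]; rewrite /layers ?subrr !mulr0 expR0 ?lerDl ?lerDr expR_ge0.
Qed.

Lemma layers_sqr s z : layers s z ^+ 2 <= 2 * layers (2 * s) z.
Proof.
have -> : layers (2 * s) z = expR (- s * z) ^+ 2 + expR (s * (z - 1)) ^+ 2.
  by rewrite /layers !expr2 -!expRD; congr (expR _ + expR _); ring.
rewrite /layers; have := sqr_ge0 (expR (- s * z) - expR (s * (z - 1))); nra.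
Qed.

(** When nu s^2 = 1 the factor exp(t) makes the layers an exact solution of the heat
    equation of viscosity nu; the terms p t and r t absorb source terms of size p,
    and of size r exp(t) concentrated in the layers. *)
Definition barrier p q r s t z : R := p * t + (q + r * t) * expR t * layers s z.

Lemma barrier_t p q r s t z : is_derive t 1 (barrier p q r s ^~ z)
  (p + (r * expR t + (q + r * t) * expR t) * layers s z).
Proof.
have d1 := derZ p (derI t).
have d2 := derD (derC t q) (derZ r (derI t)).
have d3 := derM (derM d2 (is_derive_expR t)) (derC t (layers s z)).
apply: der_eq (derD d1 d3) _; ring.
Qed.

Lemma barrier_z p q r s t z : is_derive z 1 (barrier p q r s t)
  ((q + r * t) * expR t * layers' s z).
Proof.
apply: der_eq (derD (derC z (p * t)) (derZ _ (layers_der s z))) _.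
by rewrite add0r.
Qed.

Lemma barrier_zz q r s t z : is_derive z 1 (fun z => (q + r * t) * expR t * layers' s z)
  ((q + r * t) * expR t * (s ^+ 2 * layers s z)).
Proof. exact: derZ (layers'_der s z). Qed.

Lemma barrier_continuous T p q r s :
  continuous3 (cylinder T) (const_x (barrier p q r s)).
Proof.
have c1 : continuous (fun u : R * R * R => u.1.1).
  by move=> u; apply: (@continuous_comp _ _ _ fst fst); exact: cvg_fst.
have c2 : continuous (fun u : R * R * R => u.2) by move=> u; exact: cvg_snd.
have cE : continuous (fun t : R => expR t).
  by move=> t; exact: der_continuous (is_derive_expR t).
have cL : continuous (layers s) by move=> z; exact: der_continuous (layers_der s z).
apply: continuous_subspaceT => u; rewrite /const_x /barrier.
apply: cvgD; first by apply: cvgM; [exact: cvg_cst|exact: c1].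
apply: cvgM; [apply: cvgM|].
- by apply: cvgD; [exact: cvg_cst|apply: cvgM; [exact: cvg_cst|exact: c1]].
- by apply: (continuous_comp (f := fun u : R * R * R => u.1.1)); [exact: c1|exact: cE].
- by apply: (continuous_comp (f := fun u : R * R * R => u.2)); [exact: c2|exact: cL].
Qed.

Lemma barrier_super nu p q r s t z : nu * s ^+ 2 = 1 ->
  p + (r * expR t + (q + r * t) * expR t) * layers s z
  - nu * ((q + r * t) * expR t * (s ^+ 2 * layers s z)) =
  p + r * expR t * layers s z.
Proof.
move=> ns; have -> : nu * ((q + r * t) * expR t * (s ^+ 2 * layers s z)) =
  (nu * s ^+ 2) * ((q + r * t) * expR t * layers s z) by ring.
by rewrite ns; ring.
Qed.

Lemma der_bound f x a N : is_derive x 1 f a ->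
  (forall h, `|f (x + h) - f x| <= N * `|h|) -> `|a| <= N.
Proof.
move=> fa fN; apply/ler_addgt0Pr => e e0.
have [d d0 dP] := (der_epsP _ _ _).1 fa e e0.
have hd : `|d / 2| < d by rewrite ger0_norm ?divr_ge0 ?(ltW d0)//; lra.
have h0 : 0 < `|d / 2| by rewrite normr_gt0 gt_eqF// divr_gt0.
rewrite -(ler_pM2r h0) -normrM.
have -> : a * (d / 2) = (f (x + d / 2) - f x) - (f (x + d / 2) - f x - a * (d / 2)) by ring.
by rewrite (le_trans (ler_normB _ _))// mulrDl lerD// dP.
Qed.

End Barrier.

(** * Norms of functions below a barrier *)
Section Norms.
Context {R : realType}.
Implicit Types (x y z t s A B X : R).

(** Monotonicity of the integral of nonnegative functions, which holds without
    measurability since it is a supremum over simple functions. *)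
Lemma integral_mono d (T : measurableType d) (mu : {measure set T -> \bar R})
    (f g : T -> \bar R) : (forall u, 0 <= f u)%E -> (forall u, f u <= g u)%E ->
  (\int[mu]_u f u <= \int[mu]_u g u)%E.
Proof.
move=> f0 fg; have g0 u : (0 <= g u)%E by exact: le_trans (f0 u) (fg u).
rewrite !ge0_integralTE//; apply: le_ereal_sup => _ [h hf <-]; exists h => // u.
exact: le_trans (hf u) (fg u).
Qed.

(** The square of the layers has integral of order 1 / s, the width of the layers.
    With 1 / s = nu3^(1/2) this is the source of the exponent 1/4. *)
Lemma L2_Omega_le L (w : R * R -> R) A B s X : 0 < L -> 0 < s -> 0 <= X ->
  0 <= A -> 0 <= B ->
  (forall p, Omega L p -> 0 <= w p <= A + B * layers s p.2) ->
  L * (2 * A ^+ 2 + 4 * B ^+ 2 / s) <= X ^+ 2 ->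
  (Lnorm_on lebesgue2 2%:E (Omega L) (fun p => (w p)%:E) <= X%:E)%E.
Proof.
move=> L0 s0 X0 A0 B0 wAB AX.
pose G z := 2 * A ^+ 2 + 4 * B ^+ 2 * layers (2 * s) z.
pose H z := 2 * A ^+ 2 * z + 4 * B ^+ 2 * ((2 * s) ^- 2 * layers' (2 * s) z).
have s2 : 0 < 2 * s by rewrite mulr_gt0.
have dH z : is_derive z 1 H (G z).
  apply: der_eq (derD (derZ _ (derI z)) (derZ _ (derZ _ (layers'_der (2 * s) z)))) _.
  by rewrite /G mulr1 mulKf// expf_eq0 gt_eqF.
have G0 z : 0 <= G z.
  by rewrite addr_ge0 ?mulr_ge0 ?exprn_ge0 ?layers_ge0.
have dG z : is_derive z 1 G (0 + 4 * B ^+ 2 * layers' (2 * s) z).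
  by apply: derD (derC _ _) (derZ _ _); exact: layers_der.
have cG : continuous G by move=> z; exact: der_continuous (dG z).
have I := tensor_integral L0 (@cst_continuous _ _ (1:R)) cG (fun _ => ler01) G0 (@derI R) dH.
have H1 : H 1 - H 0 <= 2 * A ^+ 2 + 4 * B ^+ 2 / s.
  rewrite /H /layers' subrr !mulr0 !mulr1 sub0r !expR0 mulrN1.
  have e0 := expR_ge0 (- (2 * s)).
  set E := expR _ in e0 *.
  have -> : 2 * A ^+ 2 + 4 * B ^+ 2 * ((2 * s) ^- 2 * (- (2 * s) * E + 2 * s * 1)) -
    (0 + 4 * B ^+ 2 * ((2 * s) ^- 2 * (- (2 * s) * 1 + 2 * s * E))) =
    2 * A ^+ 2 + 4 * B ^+ 2 / s * (1 - E) by field; rewrite gt_eqF.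
  have : 0 <= 4 * B ^+ 2 / s * E.
    by rewrite mulr_ge0// divr_ge0 ?(ltW s0)// mulr_ge0// exprn_ge0.
  lra.
have Int : (\int[lebesgue2]_p (`|((fun p => (w p)%:E) \_ (Omega L)) p| `^ 2) <= (X ^+ 2)%:E)%E.
  apply: (@le_trans _ _ (\int[lebesgue2]_(p in Omega L) (1 * G p.2)%:E)%E); last first.
    rewrite I lee_fin (le_trans _ AX)// subr0 ler_wpM2l// ltW//.
  rewrite [leRHS]integral_mkcond; apply: integral_mono => p; first exact: poweR_ge0.
  rewrite !patchE; case: ifPn => [|_]; last by rewrite abse0 poweR0r// pnatr_eq0.
  rewrite inE => /wAB /andP[w0 wB]; rewrite abse_EFin poweR_EFin powR_mulrn//.
  rewrite lee_fin mul1r ger0_norm//.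
  have : w p ^+ 2 <= (A + B * layers s p.2) ^+ 2.
    by rewrite lerXn2r ?nnegrE// (le_trans w0).
  have := ler_wpM2l (exprn_ge0 2 B0) (layers_sqr s p.2).
  have := sqr_ge0 (A - B * layers s p.2); rewrite /G; nra.
rewrite /Lnorm_on unlock.
apply: (@le_trans _ _ (((X ^+ 2)%:E) `^ 2^-1)%E).
  apply: gt0_ler_poweR => //; rewrite ?in_itv/= ?leey ?andbT//.
    by apply: integral_ge0 => p _; exact: poweR_ge0.
  by rewrite lee_fin exprn_ge0.
rewrite poweR_EFin lee_fin powR12_sqrt ?exprn_ge0//.
by rewrite sqrtr_sqr ger0_norm.
Qed.

Lemma Linfty_le T (N : R -> \bar R) X : 0 <= X ->
  (forall t, 0 < t < T -> (0 <= N t <= X%:E)%E) ->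
  (Lnorm_on (@lebesgue_measure R) +oo%E `]0%R, T[ N <= X%:E)%E.
Proof.
move=> X0 NX; rewrite /Lnorm_on unlock; case: ifP => // _.
apply/ess_supP; apply: nearW => t /=; rewrite patchE; case: ifPn => [|_].
  by rewrite inE /= in_itv /= => /NX /andP[N0 ?]; rewrite gee0_abs.
by rewrite abse0.
Qed.

End Norms.

(** * The vanishing viscosity estimate *)
Section Final.
Context {R : realType}.
Implicit Types (x y z w h t s : R).

Lemma tame_mono (K K' : R) v : K <= K' -> tame K v -> tame K' v.
Proof.
move=> KK tv r s al h x z rs h8 z0 z1; apply: le_trans (tv r s al h x z rs h8 z0 z1) _.
by rewrite ler_wpM2r// mulr_ge0 ?exprn_ge0//; case/andP: h8.
Qed.

Lemma norm_of_signs (y q : R) : (forall sg, `|sg| = 1 -> sg * y <= q) -> `|y| <= q.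
Proof.
move=> H; have := H 1 (normr1 _); have := H (-1) (normrN1 _).
by rewrite mulN1r mul1r ler_norml => h1 h2; apply/andP; split; lra.
Qed.

Lemma dx_const_x (w : R -> R -> R) t x z : dx (const_x w t) x z = 0.
Proof. by rewrite /dx /const_x derive1_cst. Qed.

Variables (L T : R) (a : R -> R) (b : R -> R -> R) (f1 : R -> R -> R)
  (f2 : R -> R -> R -> R) (v1 : R -> R -> R) (v2 : R -> R -> R -> R).
(* q is the fourth root of nu3, so that the layers have width q^2. *)
Variables (nu1 nu3 q : R) (u1 : R -> R -> R) (u2 : R -> R -> R -> R).
Hypothesis L0 : 0 < L.
Hypothesis T0 : 0 < T.
Hypothesis nu1_01 : 0 < nu1 <= 1.
Hypothesis q01 : 0 < q <= 1.
Hypothesis nu3E : nu3 = q ^+ 4.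
Hypothesis euler : euler_solution L T a b f1 f2 v1 v2.
Hypothesis viscous : viscous_solution L T nu1 nu3 a b f1 f2 u1 u2.
Variable K : R.
Hypothesis K0 : 0 <= K.
Hypothesis ta : tame K (fun _ z => a z).
Hypothesis tb : tame K b.
Hypothesis tf1 : forall t, 0 <= t <= T -> tame K (const_x f1 t).
Hypothesis tf2 : forall t, 0 <= t <= T -> tame K (f2 t).

Let N := K * (1 + T).
Let D := distortion T K.
Let M2 := K * (1 + 2 * D + D ^+ 2 + D) * (1 + T).
Let M := N + M2.
Let s := (q ^+ 2)^-1.

Let N0 : 0 <= N. Proof. by rewrite mulr_ge0// addr_ge0// ltW. Qed.

Let M2_ge0 : 0 <= M2.
Proof.
have T1 := ltW T0; have D0 : 0 <= D by rewrite /D /distortion !mulr_ge0 ?addr_ge0.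
rewrite /M2 mulr_ge0 ?addr_ge0// mulr_ge0//.
by have := sqr_ge0 D; lra.
Qed.

Let M0 : 0 <= M. Proof. exact: addr_ge0 N0 M2_ge0. Qed.

Let q0 : 0 < q. Proof. by case/andP: q01. Qed.

Let nu3_0 : 0 < nu3. Proof. by rewrite nu3E exprn_gt0. Qed.

Let nu3_q : nu3 <= q.
Proof. by rewrite nu3E exprS ler_piMr ?(ltW q0)// exprn_ile1 ?(ltW q0)//; case/andP: q01. Qed.

Let nu3_s : nu3 * s ^+ 2 = 1.
Proof. by rewrite nu3E /s exprVn -exprM mulfV// expf_eq0 gt_eqF. Qed.

(** The solution v1 does not vanish on the walls; this bound is the height of the
    boundary layers of u1 - v1. *)
Lemma wall_v1 t z : 0 <= t <= T -> 0 <= z <= 1 -> `|v1 t z| <= N.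
Proof.
move=> tT z01; have [[cv _ _] _ _ _] := euler.
apply: (closed_strip_bound (x := 0) cv tT _ z01) => w w01.
have tv := euler_v1_tame T0 euler K0 ta tf1 tT.
exact: (tame_bound (v := const_x v1 t) tv 0 w01).
Qed.

Lemma wall_v2 t x z : 0 <= t <= T -> 0 <= z <= 1 -> `|v2 t x z| <= N.
Proof.
move=> tT z01; have [_ [cv _ _] _ _] := euler.
apply: (closed_strip_bound cv tT _ z01) => w w01.
exact: (euler_v2_bound T0 euler tb tf2).
Qed.

Lemma wall01 z : z = 0 \/ z = 1 -> 0 <= z <= 1.
Proof. by move=> [->|->]; rewrite ?lexx ?ler01. Qed.

Lemma barrier_wall p r t z : 0 <= p -> 0 <= r -> 0 <= t -> z = 0 \/ z = 1 ->
  N <= barrier p N r s t z.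
Proof.
move=> p0 r0 t0 /(layers_wall s) l1.
have e1 : 1 <= expR t by rewrite -expR0 ler_expR.
have el : 1 <= expR t * layers s z.
  by rewrite -[1]mulr1 ler_pM.
have pt : 0 <= p * t by rewrite mulr_ge0.
have rt : 0 <= r * t by rewrite mulr_ge0.
rewrite /barrier -mulrA.
apply: (@le_trans _ _ ((N + r * t) * 1)); first by rewrite mulr1 lerDl.
apply: (@le_trans _ _ ((N + r * t) * (expR t * layers s z))); last by rewrite lerDr.
by rewrite ler_wpM2l// addr_ge0.
Qed.

Lemma barrier_ge0 p r t z : 0 <= p -> 0 <= r -> 0 <= t -> 0 <= barrier p N r s t z.
Proof.
move=> p0 r0 t0; have qr : 0 <= N + r * t by rewrite addr_ge0// mulr_ge0.
by rewrite /barrier addr_ge0// !mulr_ge0// ?expR_ge0// layers_ge0.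
Qed.

(** The second differences of v1 contribute a source of size nu3, and the wall values
    of v1 a boundary layer. *)
Lemma viscous_u1_close t z : 0 <= t < T -> 0 <= z <= 1 ->
  `|u1 t z - v1 t z| <= barrier (N * nu3) N 0 s t z.
Proof.
move=> tT z01; apply: norm_of_signs => sg sg1.
have [ru _ [_ iu _] bu eu] := viscous.
have [[cv dv _] _ [_ iv _] ev] := euler.
have tv t' : 0 <= t' <= T -> tame N (const_x v1 t').
  exact: (euler_v1_tame T0 euler K0 ta tf1).
have p0 : 0 <= N * nu3 by rewrite mulr_ge0// ltW.
change (sg * (const_x u1 t 0 z - const_x v1 t 0 z) <= barrier (N * nu3) N 0 s t z).
apply: (@comparison R L T 0 nu3 N 0 sg (const_x u1) (const_x v1) (const_x f1)
  (fun _ _ => 0) (fun _ _ => 0) (barrier (N * nu3) N 0 s)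
  _ _ _ L0 T0 (lexx 0) (ltW nu3_0) sg1 ru cv dv _ _ _ _ _ _ _
  (@barrier_continuous R T _ _ _ _) (barrier_t _ _ _ _) (barrier_z _ _ _ _)
  (barrier_zz _ _ _) _ _ _ t 0 z tT z01).
- by move=> ? ? ? ? x.
- by move=> ? ? ? ? x.
- by move=> t' x' z' /eu[E _]; rewrite !mul0r addr0 subr0; exact: E.
- by move=> t' x' z' /ev[E _]; rewrite mul0r addr0; exact: E.
- by move=> t' x' z' _; rewrite dx_const_x normr0.
- move=> t' x' z' h _; rewrite /const_x.
  have -> : v1 t' z' + v1 t' z' - 2 * v1 t' z' = 0 by ring.
  by rewrite normr0 mulr_ge0// sqr_ge0.
- move=> t' x' z' h [[/= t01 _] _] h8 zh0 zh1.
  have tT' : 0 <= t' <= T by move: t01; rewrite in_itv/= => /andP[/ltW -> /ltW ->].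
  exact: (tame_zz (v := const_x v1 t') (tv t' tT') x' h8 zh0 zh1).
- move=> t' z' /andP[t0 _] _; rewrite (barrier_super _ _ _ _ _ nu3_s).
  by rewrite subrr normr0 mul0r add0r add0r !mul0r addr0 mulrC.
- move=> x' z' z'01; rewrite /const_x iu// iv// subrr mulr0.
  by rewrite barrier_ge0.
- move=> t' x' z' t'T z'01; have /andP[t0 _] := t'T.
  apply: le_trans (barrier_wall p0 (lexx 0) t0 z'01).
  rewrite /const_x (bu t' 0 z' t'T z'01).1 sub0r (le_trans (ler_norm _))//.
  by rewrite normrM sg1 mul1r normrN wall_v1// wall01.
Qed.

Let p2 := M * (nu1 + nu3) + N * (N * nu3 * T).

Let p2_ge0 : 0 <= p2.
Proof.
have /andP[/ltW n1 _] := nu1_01; have n3 := ltW nu3_0; have T1 := ltW T0.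
apply: addr_ge0; first by apply: mulr_ge0 => //; exact: addr_ge0.
exact: (mulr_ge0 N0 (mulr_ge0 (mulr_ge0 N0 n3) T1)).
Qed.

(** The sources are the second differences of v2, of size nu1 + nu3, and the drift
    error (u1 - v1) times the x-derivative of v2.  The latter is again of size nu3
    plus a boundary layer of the same width, which the r t term absorbs. *)
Lemma viscous_u2_close t x z : 0 <= t < T -> 0 <= z <= 1 ->
  `|u2 t x z - v2 t x z| <= barrier p2 N (N * N) s t z.
Proof.
move=> tT z01; apply: norm_of_signs => sg sg1.
have [_ ru [pu _ iu] bu eu] := viscous.
have [_ [cv dv _] [pv _ iv] ev] := euler.
have /andP[nu1_0 _] := nu1_01.
have p20 := p2_ge0.
have NN0 : 0 <= N * N := mulr_ge0 N0 N0.
have op t' x' z' : open_cylinder T (t', x', z') -> 0 <= t' <= T /\ 0 < z' < 1.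
  move=> [[/= + _]]; rewrite /= !in_itv/= => /andP[t0 t1] z'01.
  by rewrite (ltW t0) (ltW t1).
apply: (@comparison R L T nu1 nu3 M N sg u2 v2 f2 u1 v1 (barrier p2 N (N * N) s)
  _ _ _ L0 T0 (ltW nu1_0) (ltW nu3_0) sg1 ru cv dv pu pv _ _ _ _ _
  (@barrier_continuous R T _ _ _ _) (barrier_t _ _ _ _) (barrier_z _ _ _ _)
  (barrier_zz _ _ _) _ _ _ t x z tT z01).
- by move=> t' x' z' /eu[].
- by move=> t' x' z' /ev[].
- move=> t' x' z' opt; have [tT' z01'] := op _ _ _ opt.
  have [_ dvx] := dv _ _ _ opt.
  by apply: (der_bound (der_derive1 dvx)) => h; exact: (euler_v2_x T0 euler tb tf2).
- move=> t' x' z' h opt; have [tT' z01'] := op _ _ _ opt.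
  apply: le_trans (euler_v2_xx T0 euler tb tf2 x' h tT' z01') _.
  by rewrite ler_wpM2r ?sqr_ge0// lerDl.
- move=> t' x' z' h opt h8 zh0 zh1; have [tT' z01'] := op _ _ _ opt.
  apply: le_trans (euler_v2_zz T0 euler K0 ta tb tf1 tf2 x' tT' h8 zh0 zh1) _.
  by rewrite ler_wpM2r ?sqr_ge0// lerDr.
- move=> t' z' /andP[t0 t1] /andP[z0 z1]; rewrite (barrier_super _ _ _ _ _ nu3_s).
  have tT' : 0 <= t' < T by rewrite (ltW t0).
  have z01' : 0 <= z' <= 1 by rewrite !ltW.
  have := ler_wpM2r N0 (viscous_u1_close tT' z01').
  have : N * nu3 * t' * N <= N * (N * nu3 * T).
    by rewrite mulrC ler_wpM2l// ler_wpM2l ?(ltW t1)// mulr_ge0// ltW.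
  rewrite /barrier /p2; nra.
- move=> x' z' z'01; rewrite iu// iv// subrr mulr0.
  by rewrite barrier_ge0.
- move=> t' x' z' t'T z'01; have /andP[t0 _] := t'T.
  apply: le_trans (barrier_wall p20 NN0 t0 z'01).
  rewrite (bu t' x' z' t'T z'01).2 sub0r (le_trans (ler_norm _))//.
  by rewrite normrM sg1 mul1r normrN wall_v2// wall01.
Qed.

Definition rate_const : R :=
  1 + L * (2 * ((N + M + N * N * T) * T) ^+ 2 + 4 * ((2 * N + N * N * T) * expR T) ^+ 2).

Lemma Linfty_L2_close :
  (Linfty_L2 L T (fun t z => (u1 t z - v1 t z)%R) (fun t x z => (u2 t x z - v2 t x z)%R)
   <= (rate_const * (q + nu1))%:E)%E.
Proof.
have T1 := ltW T0; have /andP[nu1_0 _] := nu1_01.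
(* A0 and B0 collect the constants of the two barriers at time T. *)
pose A0 := (N + M + N * N * T) * T; pose B0 := (2 * N + N * N * T) * expR T.
have NNT : 0 <= N * N * T := mulr_ge0 (mulr_ge0 N0 N0) T1.
have A00 : 0 <= A0 := mulr_ge0 (addr_ge0 (addr_ge0 N0 M0) NNT) T1.
have B00 : 0 <= B0 :=
  mulr_ge0 (addr_ge0 (mulr_ge0 (ler0n R 2) N0) NNT) (expR_ge0 T).
have qn : 0 < q + nu1 by rewrite addr_gt0.
have S0 : 0 <= L * (2 * A0 ^+ 2 + 4 * B0 ^+ 2).
  apply: mulr_ge0; first exact: ltW.
  by have := sqr_ge0 A0; have := sqr_ge0 B0; lra.
have C1 : 1 <= rate_const by rewrite /rate_const -/A0 -/B0 lerDl.
have X0 : 0 <= rate_const * (q + nu1).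
  by rewrite mulr_ge0 ?(ltW qn)// (le_trans ler01).
apply: Linfty_le => // t /andP[t0 tT]; apply/andP; split.
  by rewrite /Lnorm_on; exact: Lnorm_ge0.
apply: (@L2_Omega_le R L _ (A0 * (q + nu1)) B0 s) => //.
- by rewrite invr_gt0 exprn_gt0.
- by rewrite mulr_ge0// ltW.
- move=> [x z] [_ /=]; rewrite in_itv/= => z01; rewrite sqrtr_ge0/=.
  have tT' : 0 <= t < T by rewrite (ltW t0).
  have c1 := viscous_u1_close tT' z01; have c2 := viscous_u2_close x tT' z01.
  set w1 := u1 t z - v1 t z in c1 *; set w2 := u2 t x z - v2 t x z in c2 *.
  have sw : Num.sqrt (w1 ^+ 2 + w2 ^+ 2) <= `|w1| + `|w2|.
    rewrite -[leRHS]ger0_norm ?addr_ge0// -sqrtr_sqr ler_wsqrtr//.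
    rewrite -(real_normK (num_real w1)) -(real_normK (num_real w2)).
    by have := mulr_ge0 (normr_ge0 w1) (normr_ge0 w2); nra.
  apply: (le_trans sw); apply: (le_trans (lerD c1 c2)).
  have l0 := layers_ge0 s z.
  have eT : expR t <= expR T by rewrite ler_expR ltW.
  have e0 := expR_ge0 t.
  have E1 : (N * nu3 + p2) * t <= A0 * (q + nu1).
    apply: (@le_trans _ _ ((N * nu3 + p2) * T)).
      by rewrite ler_wpM2l ?(ltW tT)// addr_ge0// mulr_ge0// ltW.
    have -> : A0 * (q + nu1) = (N + M + N * N * T) * (q + nu1) * T by rewrite /A0; ring.
    rewrite ler_wpM2r// /p2.
    have n3 := nu3_q; have n1 : nu3 <= q + nu1 by lra.
    have n2 : nu1 + nu3 <= q + nu1 by lra.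
    have := ler_wpM2l N0 n1; have := ler_wpM2l M0 n2; have := ler_wpM2l NNT n1; lra.
  have E2 : (N + 0 * t + (N + N * N * t)) * expR t * layers s z <= B0 * layers s z.
    rewrite ler_wpM2r// ler_pM// ?expR_ge0//.
      exact: (addr_ge0 (addr_ge0 N0 (mulr_ge0 (lexx 0) (ltW t0)))
        (addr_ge0 N0 (mulr_ge0 (mulr_ge0 N0 N0) (ltW t0)))).
    have := ler_wpM2l (mulr_ge0 N0 N0) (ltW tT); lra.
  rewrite /barrier; lra.
- rewrite /s invrK.
  have q2 : q ^+ 2 <= (q + nu1) ^+ 2.
    by rewrite lerXn2r ?nnegrE ?(ltW q0) ?(ltW qn)// lerDl ltW.
  apply: (@le_trans _ _ (L * (2 * A0 ^+ 2 + 4 * B0 ^+ 2) * (q + nu1) ^+ 2)).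
    rewrite -[leRHS]mulrA ler_wpM2l ?(ltW L0)// exprMn.
    have := ler_wpM2l (mulr_ge0 (ler0n R 4) (sqr_ge0 B0)) q2; lra.
  rewrite [leRHS]exprMn ler_wpM2r ?sqr_ge0//.
  apply: (@le_trans _ _ rate_const); first by rewrite /rate_const -/A0 -/B0 lerDr.
  by rewrite expr2 ler_peMl// (le_trans ler01).
Qed.

End Final.

Unset Implicit Arguments.

Theorem corollary2p1 (R : realType) (L T : R) (m : nat)
    (a : R -> R) (b : R -> R -> R) (f1 : R -> R -> R) (f2 : R -> R -> R -> R) :
  0 < L -> 0 < T -> (5 < m)%N ->
  Hm L m (fun _ z => a z) -> Hm L m b ->
  smooth_cylinder T (const_x f1) -> smooth_cylinder T f2 ->
  (forall t z, 0 <= t <= T -> 0 <= z <= 1 -> periodic (f2 t ^~ z) L) ->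
  exists C : R, forall nu1 nu3 : R,
    0 < nu1 <= 1 -> 0 < nu3 <= 1 ->
    compatible nu1 nu3 a b f1 f2 ->
    forall (u1 : R -> R -> R) (u2 : R -> R -> R -> R)
           (v1 : R -> R -> R) (v2 : R -> R -> R -> R),
    viscous_solution L T nu1 nu3 a b f1 f2 u1 u2 ->
    euler_solution L T a b f1 f2 v1 v2 ->
    (Linfty_L2 L T (fun t z => (u1 t z - v1 t z)%R)
                   (fun t x z => (u2 t x z - v2 t x z)%R)
     <= (C * (nu3 `^ (4^-1) + nu1))%:E)%E.
Proof.
move=> L0 T0 m5 Ha Hb sf1 sf2 pf2.
have [Ka Ka0 ta] := Hm_tame L0 m5 Ha; have [Kb Kb0 tb] := Hm_tame L0 m5 Hb.
have [Kf Kf0 tf] : exists2 K, 0 <= K &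
    forall t, 0 <= t <= T -> tame K (const_x f1 t).
  exact: (smooth_tame L0 (ltW T0) sf1).
have [Kg Kg0 tg] : exists2 K, 0 <= K & forall t, 0 <= t <= T -> tame K (f2 t).
  apply: (smooth_tame L0 (ltW T0) sf2) => t x z tT /andP[z0 z1].
  by apply: pf2 => //; rewrite (ltW z0) (ltW z1).
pose K := Ka + Kb + Kf + Kg.
exists (rate_const L T K) => nu1 nu3 n1 /andP[n30 n31] _ u1 u2 v1 v2 hv he.
apply: (@Linfty_L2_close R L T a b f1 f2 v1 v2 nu1 nu3 _ u1 u2 L0 T0 n1 _ _ he hv).
- have i4 : 0 <= 4^-1 :> R by rewrite invr_ge0.
  have := ge0_ler_powR i4 (ltW n30 : nu3 \in Num.nneg) (ler01 : 1 \in Num.nneg) n31.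
  by rewrite powR1 powR_gt0.
- by rewrite -powR_mulrn ?powR_ge0// -powRrM mulVf ?pnatr_eq0// powRr1// ltW.
- by rewrite !addr_ge0.
- by apply: tame_mono ta; rewrite /K; lra.
- by apply: tame_mono tb; rewrite /K; lra.
- by move=> t tT; apply: tame_mono (tf t tT); rewrite /K; lra.
- by move=> t tT; apply: tame_mono (tg t tT); rewrite /K; lra.
Qed.
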